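(* Let $r,t \ge 1$ be integers. If $M$ is a simple rank-$r$ matroid with no $(t+1)$-claw, then $|E(M)| \ge |E(M_{r,t})|$. If equality holds and $r \ge 2t$, then $M \cong M_{r,t}$.
   Context: A claw of a matroid $M$ is a set $S \subseteq E(M)$ that is both a flat and an independent set of $M$; a $k$-claw is a claw of size $k$. For integers $r,t \ge 1$, $M_{r,t}$ denotes the matroid that is the direct sum of $t$ (possibly empty, i.e. rank-$0$) binary projective geometries whose ranks sum to $r$ and pairwise differ by at most $1$ (a rank-$n$ binary projective geometry $\mathrm{PG}(n-1,2)$ has $2^n-1$ elements). *)

(* Defs.v *)
From HB Require Import structures.
From mathcomp Require Import all_boot all_order all_algebra.
Set Implicit Arguments. Unset Strict Implicit. Unset Printing Implicit Defensive.
Import GRing.Theory.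

Section Matroid.
Variable T : finType.
Variable indep : {set T} -> bool.

(* Independence axioms (I1)-(I3); ground set E(M) = all of T. *)
Definition is_matroid : Prop :=
  [/\ indep set0,
      (forall A B : {set T}, B \subset A -> indep A -> indep B) &
      (forall A B : {set T}, indep A -> indep B -> #|A| < #|B| ->
          exists2 x, x \in B :\: A & indep (x |: A))].

Definition mrank (X : {set T}) : nat :=
  \max_(Y : {set T} | (Y \subset X) && indep Y) #|Y|.

Definition is_flat (F : {set T}) : Prop :=
  forall e, e \notin F -> mrank F < mrank (e |: F).

Definition is_claw (S : {set T}) : Prop := is_flat S /\ indep S.

(* simple: no loops and no parallel pairs, i.e. every set of size <= 2
   is independent *)
Definition simple_matroid : Prop := forall e f : T, indep [set e; f].
End Matroid.

Definition matroid_iso (T T' : finType) (indep : {set T} -> bool)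
  (indep' : {set T'} -> bool) : Prop :=
  exists f : T -> T', bijective f /\ forall X : {set T}, indep X = indep' (f @: X).

(* binary projective geometry PG(n-1,2): nonzero vectors of F_2^n,
   independence = linear independence over F_2 *)
Definition PG_type (n : nat) := {v : 'rV['F_2]_n | v != 0%R}.
Definition PG_indep (n : nat) (X : {set PG_type n}) : bool :=
  free [seq val x | x <- enum X].

Definition dsum_indep (I : finType) (T : I -> finType)
  (ind : forall i, {set T i} -> bool) (X : {set {i : I & T i}}) : bool :=
  [forall i, ind i [set y : T i | Tagged T y \in X]].

(* ranks of the t summands of M_{r,t}: they sum to r and pairwise differ
   by at most 1 *)
Definition Mrt_rank (r t : nat) (i : 'I_t) : nat := (r %/ t + ((nat_of_ord i) < r %% t))%N.
Arguments Mrt_rank : clear implicits.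

Definition Mrt_type (r t : nat) : finType :=
  {i : 'I_t & PG_type (Mrt_rank r t i)}.
Definition Mrt_indep (r t : nat) : {set Mrt_type r t} -> bool :=
  @dsum_indep 'I_t (fun i => PG_type (Mrt_rank r t i)) (fun i => @PG_indep _).

(* Main.v *)
Require Import Defs.
From mathcomp Require Import all_boot all_order all_algebra.
From mathcomp Require Import zify.
Set Implicit Arguments.
Unset Strict Implicit.
Unset Printing Implicit Defensive.
Import GRing.Theory.

(* Contract a largest claw S, of size k <= t.  Claws of the simplification of M/S are claws of M,
   and each parallel class of M/S has at least two elements because S plus a single point is not
   a claw; hence |E(M)| >= k + 2 |E(si(M/S))|, the recursion satisfied by |E(M_{r,k})|, and
   convexity of 2^n gives |E(M_{r,k})| >= |E(M_{r,t})|.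
   If equality holds and t <= r, then k = t and for each t-claw S all classes of M/S are pairs; a
   claw can be moved to any given point by an exchange.  If moreover 2t <= r, comparing S with a
   t-claw of si(M/S) shows that every point off S lies on a 3-point line with exactly one s in S.
   These t classes contain no 2-claws, so the class of rank n has at least 2^n - 1 points, and
   convexity forces the ranks to add up to r and to be balanced: M is the direct sum of the
   classes.  In a class of rank n with 2^n - 1 points each line meets each hyperplane, so
   non-membership in the hyperplanes spanned by a basis gives coordinates over F_2. *)

(** * Rank, closure and claws *)

Section Rank.
Variables (T : finType) (indep : {set T} -> bool).
Hypothesis matM : is_matroid indep.
Implicit Types (X Y Z I J A B S : {set T}) (e f x y : T).
Local Notation rk := (mrank indep).

Lemma indep0 : indep set0. Proof. by case: matM. Qed.

Lemma indep_sub A B : B \subset A -> indep A -> indep B.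
Proof. by case: matM => _ + _; apply. Qed.

Lemma card_leq_rk X Y : Y \subset X -> indep Y -> #|Y| <= rk X.
Proof.
move=> sYX iY.
by apply: (leq_bigmax_cond (F := fun Y : {set T} => #|Y|)); rewrite sYX iY.
Qed.

Lemma rk_basis X : exists2 Y : {set T}, Y \subset X & indep Y /\ #|Y| = rk X.
Proof.
have h : 0 < #|[pred Y : {set T} | (Y \subset X) && indep Y]|.
  by apply/card_gt0P; exists set0; rewrite inE sub0set indep0.
have [Y /andP[sYX iY] eY] := eq_bigmax_cond (fun Y : {set T} => #|Y|) h.
by exists Y.
Qed.

Lemma rk_leq_card X : rk X <= #|X|.
Proof. by case: (rk_basis X) => Y sYX [_ <-]; apply: subset_leq_card. Qed.

Lemma rk_sub X Y : X \subset Y -> rk X <= rk Y.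
Proof.
move=> sXY; case: (rk_basis X) => Z sZX [iZ <-].
by apply: card_leq_rk => //; apply: subset_trans sXY.
Qed.

Lemma indepE X : indep X = (rk X == #|X|).
Proof.
apply/idP/eqP => [iX|eX].
  by apply/eqP; rewrite eqn_leq rk_leq_card card_leq_rk.
case: (rk_basis X) => Y sYX [iY eY].
by have /eqP <- : Y == X by rewrite eqEcard sYX eY eX leqnn.
Qed.

(** An inclusion-maximal independent set between [I] and [X] has size [rk X]; a smaller one could be
    augmented from a basis of [X]. *)
Lemma basis_extend I X : indep I -> I \subset X ->
  exists J : {set T}, [/\ I \subset J, J \subset X, indep J & #|J| = rk X].
Proof.
move=> iI sIX.
have [J /maxsetP[/andP[sJX iJ] maxJ] sIJ] :=
  @maxset_exists T (fun J => (J \subset X) && indep J) I (introT andP (conj sIX iI)).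
exists J; split=> //; apply/eqP; rewrite eqn_leq card_leq_rk //= leqNgt.
apply/negP => ltJ; case: (rk_basis X) => K sKX [iK eK].
case: matM => _ _ /(_ J K iJ iK); rewrite eK => /(_ ltJ) [x].
rewrite inE => /andP[xJ xK] ixJ.
case/negP: xJ; rewrite -(maxJ (x |: J) _ (subsetUr _ _)) ?setU11 //.
by rewrite ixJ subUset sub1set (subsetP sKX) // sJX.
Qed.

(** Extend a basis [J] of the intersection to a basis [K] of the union; [K] meets [X] and [Y] in
    independent sets whose common part contains [J]. *)
Lemma rk_submod X Y : rk (X :|: Y) + rk (X :&: Y) <= rk X + rk Y.
Proof.
case: (rk_basis (X :&: Y)) => J sJ [iJ <-].
have sJU : J \subset X :|: Y.
  by apply: subset_trans sJ _; rewrite subIset // subsetUl.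
have [K [sJK sKU iK <-]] := basis_extend iJ sJU.
have eK : K = (K :&: X) :|: (K :&: Y) by rewrite -setIUr; apply/esym/setIidPl.
have := cardsUI (K :&: X) (K :&: Y); rewrite -eK.
have : #|K :&: X| <= rk X.
  by apply: card_leq_rk; rewrite ?subsetIr //; apply: indep_sub iK; rewrite subsetIl.
have : #|K :&: Y| <= rk Y.
  by apply: card_leq_rk; rewrite ?subsetIr //; apply: indep_sub iK; rewrite subsetIl.
have : #|J| <= #|K :&: X :&: (K :&: Y)|.
  by apply: subset_leq_card; rewrite setIACA setIid subsetI sJK.
lia.
Qed.

Lemma rkU1_leq e X : rk (e |: X) <= (rk X).+1.
Proof.
have := rk_submod [set e] X.
by have := rk_leq_card [set e]; rewrite cards1; lia.
Qed.

Definition cl X := [set e | rk (e |: X) == rk X].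

Lemma sub_cl X : X \subset cl X.
Proof. by apply/subsetP=> x xX; rewrite inE (setUidPr _) // sub1set. Qed.

Lemma mem_cl X x : x \in X -> x \in cl X. Proof. exact: (subsetP (sub_cl X)). Qed.

Lemma rk_notin_cl X e : e \notin cl X -> rk (e |: X) = (rk X).+1.
Proof.
rewrite inE => h; apply/eqP; rewrite eqn_leq rkU1_leq ltn_neqAle eq_sym h.
by rewrite rk_sub // subsetUr.
Qed.

Lemma cl_mono X Y e : X \subset Y -> e \in cl X -> e \in cl Y.
Proof.
move=> sXY; rewrite !inE => /eqP h.
have := rk_submod Y (e |: X).
have -> : Y :|: (e |: X) = e |: Y by rewrite setUCA (setUidPl sXY).
have : rk X <= rk (Y :&: (e |: X)) by rewrite rk_sub // subsetI sXY subsetUr.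
have : rk Y <= rk (e |: Y) by rewrite rk_sub // subsetUr.
by rewrite h => h1 h2 h3; apply/eqP; lia.
Qed.

Lemma rk_clU X Z : Z \subset cl X -> rk (X :|: Z) = rk X.
Proof.
have [n] := ubnP #|Z|; elim: n Z => // n IH Z.
have [->|[z zZ]] := set_0Vmem Z; first by rewrite setU0.
rewrite (cardsD1 z) zZ ltnS add1n => ltZ sZ.
have sZ' : Z :\ z \subset cl X by rewrite (subset_trans _ sZ) // subD1set.
rewrite -(setD1K zZ) setUCA -(IH _ ltZ sZ').
have : z \in cl (X :|: Z :\ z).
  by apply: (cl_mono (X := X)); rewrite ?subsetUl // (subsetP sZ).
by rewrite inE => /eqP.
Qed.

Lemma cl_trans X Y e : Y \subset cl X -> e \in cl Y -> e \in cl X.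
Proof.
move=> sY eY.
have : e \in cl (X :|: Y) by apply: cl_mono eY; rewrite subsetUr.
rewrite !inE (rk_clU sY) => /eqP h; rewrite eqn_leq [X in _ && X]rk_sub ?subsetUr //.
by rewrite andbT -{1}h rk_sub // setUS // subsetUl.
Qed.

Lemma indepU1 X e : e \notin X -> indep X -> indep (e |: X) = (e \notin cl X).
Proof.
by move=> eX iX; rewrite !inE indepE cardsU1 eX /= add1n;
   have := rkU1_leq e X; have : rk X <= rk (e |: X) by [rewrite rk_sub // subsetUr];
   move: iX; rewrite indepE => /eqP ->; lia.
Qed.

Lemma indepU1_cl X e : e \notin X -> indep (e |: X) -> e \notin cl X.
Proof.
by move=> eX ie; rewrite -indepU1 //; apply: indep_sub ie; rewrite subsetUr.
Qed.

Lemma cl_exchange X x y : y \notin cl X -> y \in cl (x |: X) -> x \in cl (y |: X).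
Proof.
move=> /rk_notin_cl h; rewrite !inE => /eqP h2.
have := rkU1_leq x X; have : rk (y |: X) <= rk (x |: (y |: X)).
  by rewrite rk_sub // subsetUr.
by move: h2; rewrite setUCA h => ->; lia.
Qed.

(** Submodularity for [e |: A] and [e |: B], whose ranks are [#|A|] and [#|B|], leaves
    [e |: A :&: B] a rank of at most [#|A :&: B|]. *)
Lemma cl_inter A B e : indep (A :|: B) -> e \in cl A -> e \in cl B -> e \in cl (A :&: B).
Proof.
move=> iAB; rewrite !inE => /eqP eA /eqP eB.
have iA : indep A by apply: indep_sub iAB; rewrite subsetUl.
have iB : indep B by apply: indep_sub iAB; rewrite subsetUr.
have iI : indep (A :&: B) by apply: indep_sub iA; rewrite subsetIl.
move: iA iB iI (iAB); rewrite !indepE => /eqP hA /eqP hB /eqP hI /eqP hU.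
have := rk_submod (e |: A) (e |: B); rewrite -setUIr eA eB hA hB hI.
have : rk (A :|: B) <= rk (e |: A :|: (e |: B)).
  by rewrite rk_sub // setUSS ?subsetUr.
have : rk (A :&: B) <= rk (e |: A :&: B) by rewrite rk_sub // subsetUr.
rewrite hU hI; have := cardsUI A B; lia.
Qed.

Lemma indep_span I J : indep I -> I \subset cl J -> #|J| <= #|I| -> indep J.
Proof.
rewrite !indepE => /eqP hI sI le; have := rk_clU sI; have := rk_leq_card J.
have : rk I <= rk (J :|: I) by rewrite rk_sub // subsetUr.
rewrite hI; lia.
Qed.

(** The carrier [T] stays fixed: points that are deleted or contracted become loops, so [nonloops]
    serves as the ground set. *)
Definition nonloops := [set e | indep [set e]].

Lemma nonloopsP X e : indep X -> e \in X -> e \in nonloops.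
Proof. by move=> iX eX; rewrite inE; apply: indep_sub iX; rewrite sub1set. Qed.

Lemma notin_nonloops X e : e \notin nonloops -> e \in cl X.
Proof.
rewrite inE => h; apply: (cl_mono (sub0set X)); apply: contraR h => h.
by rewrite -[[set e]]setU0 indepU1 ?in_set0 ?indep0.
Qed.

(* Loops are ignored: for a simple matroid with loops added, this is [is_claw] on the nonloops. *)
Definition claw S := indep S && [forall e in nonloops, indep (e |: S)].

Lemma clawP S : reflect (indep S /\ forall e, e \in nonloops -> e \in cl S -> e \in S) (claw S).
Proof.
apply: (iffP andP) => [[iS /forall_inP h]|[iS h]]; split=> //.
  move=> e eE; apply: contraLR => eS.
  by rewrite -indepU1 // h.
apply/forall_inP => e eE; have [eS|eS] := boolP (e \in S).
  by rewrite (setUidPr _) // sub1set.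
by rewrite indepU1 //; apply: contra eS; apply: h.
Qed.

Lemma claw_indep S : claw S -> indep S. Proof. by case/andP. Qed.

(** A nonloop in [cl S'] lies in the claw [S], and a member of the independent set [S] outside [S']
    is not in [cl S']. *)
Lemma claw_sub S S' : S' \subset S -> claw S -> claw S'.
Proof.
move=> sS /clawP[iS h]; have iS' := indep_sub sS iS.
apply/clawP; split=> // e eE eS'.
have eS := h _ eE (cl_mono sS eS'); apply: contraLR eS' => neS'.
by rewrite -indepU1 //; apply: indep_sub iS; rewrite subUset sub1set eS.
Qed.

Lemma claw0 : claw set0.
Proof.
apply/clawP; split; first exact: indep0.
by move=> e; rewrite inE -[[set e]]setU0 indepU1 ?in_set0 ?indep0 // => /negPf->.
Qed.

Definition simple_on := forall e f, e \in nonloops -> f \in nonloops -> indep [set e; f].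

Lemma simple_cl1 e f : simple_on -> e \in nonloops -> f \in nonloops ->
  e \in cl [set f] -> e = f.
Proof.
move=> sM eE fE h; apply/eqP; apply: contraLR h => nef.
by rewrite -indepU1 ?inE // ?sM //; move: fE; rewrite inE.
Qed.

Definition noclaw t := forall S, claw S -> #|S| <= t.

End Rank.

Section Contract.
Variables (T : finType) (indep : {set T} -> bool).
Hypothesis matM : is_matroid indep.
Hypothesis simpM : simple_on indep.
Implicit Types (A B X Y R S : {set T}) (e f x y : T).
Local Notation rk := (mrank indep).
Local Notation cl := (cl indep).
Local Notation E := (nonloops indep).

(** * Contraction of a claw *)

(* A maximal separated set has one point in each parallel class of M/S, so [contract S R],
   which has nonloops [R], is the simplification of M/S. *)
Definition separated S R :=
  (R \subset E :\: S) && [forall x in R, forall y in R, (x != y) ==> (y \notin cl (x |: S))].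

Lemma separatedP S R : reflect
  (R \subset E :\: S /\ forall x y, x \in R -> y \in R -> y \in cl (x |: S) -> x = y)
  (separated S R).
Proof.
apply: (iffP andP) => -[sR h]; split=> //.
  move=> x y xR yR yx; apply/eqP; apply: contraLR yx => nxy.
  by have /forall_inP/(_ _ xR)/forall_inP/(_ _ yR) := h; rewrite nxy.
apply/forall_inP => x xR; apply/forall_inP => y yR; apply/implyP.
by apply: contra => yx; rewrite (h x y).
Qed.

Definition contract S R X := (X \subset R) && indep (X :|: S).

Lemma card_nonloops_rk : 0 < rk setT -> exists e, e \in E.
Proof.
case: (rk_basis matM setT) => Y _ [iY <-] /card_gt0P [e eY].
by exists e; apply: (nonloopsP matM iY).
Qed.

Lemma claw1 e : e \in E -> claw indep [set e].
Proof.
move=> eE; apply/clawP => //; split; first by move: eE; rewrite inE.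
by move=> f fE /(simple_cl1 matM simpM fE eE) ->; rewrite inE.
Qed.

Section Transversal.
Variables (S R : {set T}).
Hypothesis clS : claw indep S.
Hypothesis maxR : maxset (separated S) R.

Let iS : indep S := claw_indep clS.
Let sepR : separated S R. Proof. by case/maxsetP: maxR. Qed.
Local Notation cindep := (contract S R).

Lemma transversal_nonloop x : x \in R -> x \in E.
Proof. by case/separatedP: sepR => /subsetP + _ xR => /(_ x xR); rewrite inE => /andP[]. Qed.

Lemma transversal_notin x : x \in R -> x \notin S.
Proof. by case/separatedP: sepR => /subsetP + _ xR => /(_ x xR); rewrite inE => /andP[]. Qed.

Lemma transversal_inj x y : x \in R -> y \in R -> y \in cl (x |: S) -> x = y.
Proof. by case/separatedP: sepR => _; apply. Qed.

Lemma claw_notin_cl e : e \in E -> e \notin S -> e \notin cl S.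
Proof. by move=> eE; apply: contra; case/(clawP matM): clS => _; apply. Qed.

(** If no point of [R] were parallel to [e] in M/S, then [e |: R] would be separated, against
    maximality. *)
Lemma transversal_cover e : e \in E -> e \notin S ->
  exists2 x, x \in R & e \in cl (x |: S).
Proof.
move=> eE eS; have [eR|eR] := boolP (e \in R).
  by exists e => //; apply: mem_cl; rewrite setU11.
apply/exists_inP; apply: contraNT eR => /exists_inPn h.
case/maxsetP: maxR => _ /(_ (e |: R)) <-; rewrite ?subsetUr ?setU11 //.
apply/separatedP; split.
  by rewrite subUset sub1set inE eE eS; case/separatedP: sepR.
move=> x y /setU1P[->|xR] /setU1P[->|yR] //.
- move/(cl_exchange matM (claw_notin_cl (transversal_nonloop yR) (transversal_notin yR))).
  by move=> ey; have := h y yR; rewrite ey.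
- by move=> ex; have := h x xR; rewrite ex.
- exact: transversal_inj.
Qed.

Lemma transversal_disjoint X : X \subset R -> [disjoint X & S].
Proof.
move=> /subsetP sXR; apply/pred0P => x /=; apply/negP => /andP[xX xS].
by move: (transversal_notin (sXR x xX)); rewrite xS.
Qed.

Lemma card_transversalU X : X \subset R -> #|X :|: S| = #|X| + #|S|.
Proof.
by move/transversal_disjoint; rewrite -setI_eq0 cardsU => /eqP ->; rewrite cards0 subn0.
Qed.

Lemma contract_matroid : is_matroid cindep.
Proof.
split=> [|A B sBA /andP[sAR iA]|A B /andP[sAR iA] /andP[sBR iB] ltAB].
- by rewrite /contract sub0set set0U.
- by rewrite /contract (subset_trans sBA) //; apply: (indep_sub matM) iA; rewrite setSU.
case: matM => _ _ /(_ _ _ iA iB).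
rewrite !card_transversalU // ltn_add2r => /(_ ltAB) [x].
rewrite !inE negb_or -andbA => /and3P[xA xS]; rewrite (negPf xS) orbF => xB ix.
by exists x; rewrite ?inE ?xA // /contract subUset sub1set (subsetP sBR) // sAR -setUA.
Qed.

Lemma indepU1_claw e : e \in E -> indep (e |: S).
Proof. by move: clS => /andP[_ /forall_inP]; apply. Qed.

Lemma nonloops_contract : nonloops cindep = R.
Proof.
apply/setP => x; rewrite inE /contract sub1set; case: (boolP (x \in R)) => //= xR.
by rewrite indepU1_claw // transversal_nonloop.
Qed.

Lemma contract_simple : simple_on cindep.
Proof.
move=> e f; rewrite nonloops_contract => eR fR.
rewrite /contract subUset !sub1set eR fR /= -setUA.
have ifS := indepU1_claw (transversal_nonloop fR).
have [<-|nef] := eqVneq e f; first by rewrite setUA setUid indepU1_claw ?transversal_nonloop.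
rewrite (indepU1 matM) //; last by rewrite !inE negb_or nef transversal_notin.
by apply: contra nef => h; rewrite (transversal_inj fR eR h).
Qed.

(** Let [f] lie in [cl X]. It is not in [S], as [X :|: S] is independent, so it is parallel in M/S
    to some [x] in [R], and [x] is in [X] because [X] is flat there. Now [f] lies in [cl X] and in
    [cl (x |: S)], which meet in the closure of [x]; simplicity gives [f = x]. *)
Lemma contract_claw X : claw cindep X -> claw indep X.
Proof.
move=> /andP[/andP[sXR iXS] /forall_inP clX].
have iX : indep X by apply: (indep_sub matM) iXS; rewrite subsetUl.
apply/(clawP matM); split=> // f fE fX.
have fXS : f \in cl (X :|: S) by apply: (cl_mono matM) fX; rewrite subsetUl.
have [fS|fS] := boolP (f \in S).
  have : f \notin cl X.
    rewrite -(indepU1 matM) //; last first.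
      by apply/negP => /(subsetP sXR)/transversal_notin; rewrite fS.
    by apply: (indep_sub matM) iXS; rewrite subUset sub1set inE fS orbT subsetUl.
  by rewrite fX.
have [x xR fx] := transversal_cover fE fS.
have [xX|xX] := boolP (x \in X); last first.
  have xXS : x \in cl (X :|: S).
    apply: (cl_trans matM (Y := f |: S)).
      by rewrite subUset sub1set fXS (subset_trans _ (sub_cl _ _)) // subsetUr.
    by apply: cl_exchange fx => //; rewrite claw_notin_cl.
  have := clX x; rewrite nonloops_contract => /(_ xR) /andP[_]; rewrite -setUA.
  by rewrite (indepU1 matM) ?xXS // inE negb_or xX transversal_notin.
suff -> : f = x by [].
apply: (simple_cl1 matM simpM fE (transversal_nonloop xR)).
suff -> : [set x] = X :&: (x |: S).
  by apply: (cl_inter matM) => //; rewrite setUA [X :|: _](setUidPl _) ?sub1set.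
have /eqP XS0 : X :&: S == set0 by rewrite setI_eq0 transversal_disjoint.
rewrite setIUr XS0 setU0.
by apply/esym/setIidPr; rewrite sub1set.
Qed.

Lemma contract_noclaw t : noclaw indep t -> noclaw cindep t.
Proof. by move=> h X /contract_claw; apply: h. Qed.

(** Every nonloop off [S] is parallel to a point of [R], so [S :|: R] spans; a basis of it
    containing [S], minus [S], is independent in the contraction. *)
Lemma contract_rank : mrank cindep setT + #|S| = rk setT.
Proof.
have mC := contract_matroid.
apply/eqP; rewrite eqn_leq; apply/andP; split.
  case: (rk_basis mC setT) => X _ [/andP[sXR iX] <-].
  by rewrite -card_transversalU // card_leq_rk // subsetT.
have [J [sSJ sJ iJ eJ]] := basis_extend matM iS (subsetUl S R).
have -> : rk setT = #|J|.
  rewrite eJ -(rk_clU matM (X := S :|: R) (Z := setT)) ?setUT //; apply/subsetP => e _.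
  have [eE|eE] := boolP (e \in E); last exact: notin_nonloops.
  have [eS|eS] := boolP (e \in S); first by apply: mem_cl; rewrite inE eS.
  have [x xR] := transversal_cover eE eS; apply: cl_mono => //.
  by rewrite subUset sub1set inE xR orbT subsetUl.
rewrite -(cardsID S J) (setIidPr sSJ) addnC leq_add2r card_leq_rk ?subsetT //.
by rewrite /contract subDset sJ setUC -{1}(setIidPr sSJ) setID iJ.
Qed.

(** [e |: S] is independent but too large to be a claw, so its flatness fails at some [y]. *)
Lemma claw_partner t e : noclaw indep t -> #|S| = t -> e \in E -> e \notin S ->
  exists y, [/\ y \in E, y \notin e |: S & y \in cl (e |: S)].
Proof.
move=> nc eS eE neS.
have /negP : ~ claw indep (e |: S).
  by move=> /nc; rewrite cardsU1 neS eS add1n ltnn.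
rewrite /claw indepU1_claw //= negb_forall => /existsP[y].
rewrite negb_imply => /andP[yE]; have [yeS|yeS] := boolP (y \in e |: S).
  by rewrite (setUidPr _) ?sub1set // indepU1_claw.
by rewrite (indepU1 matM) ?indepU1_claw // negbK; exists y.
Qed.

Variable p : T -> T.
Hypothesis partner : {in R, forall x, [/\ p x \in E, p x \notin x |: S & p x \in cl (x |: S)]}.

(** In M/S the point [p x] is parallel to [x], and distinct points of [R] lie in distinct parallel
    classes. *)
Lemma partner_cl x y : x \in R -> y \in R -> p x \in cl (y |: S) -> x = y.
Proof.
move=> xR yR pxy; have [pxE pxS pxx] := partner xR.
apply/esym; apply: transversal_inj => //.
apply: (cl_trans matM (Y := p x |: S)).
  by rewrite subUset sub1set pxy (subset_trans _ (sub_cl _ _)) // subsetUr.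
apply: cl_exchange => //.
by rewrite claw_notin_cl //; apply: contra pxS; apply: setU1r.
Qed.

Lemma partner_injective : {in R &, injective p}.
Proof.
move=> x y xR yR exy; apply: partner_cl => //; rewrite exy.
by case: (partner yR).
Qed.

Lemma partner_notin_transversal x : x \in R -> p x \notin R.
Proof.
move=> xR; apply/negP => pR; have [_ + pcl] := partner xR.
by rewrite -(transversal_inj xR pR pcl) setU11.
Qed.

Lemma card_partner : #|S :|: R :|: p @: R| = #|S| + #|R|.*2.
Proof.
have SRp0 : (S :|: R) :&: p @: R = set0.
  apply/setP => y; rewrite !inE; apply/negP => /andP[/orP ySR /imsetP[x xR ey]].
  have [_ + _] := partner xR; case: ySR; rewrite ey; last first.
    by rewrite (negPf (partner_notin_transversal xR)).
  by rewrite !inE => ->; rewrite orbT.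
rewrite cardsU SRp0 cards0 subn0 [S :|: R]setUC card_transversalU // (card_in_imset partner_injective); lia.
Qed.

Lemma partner_sub_nonloops : S :|: R :|: p @: R \subset E.
Proof.
apply/subsetP => x; rewrite !inE -orbA => /or3P[|/transversal_nonloop|/imsetP[y yR ->]].
- by move/(nonloopsP matM iS); rewrite inE.
- by rewrite inE.
by case: (partner yR); rewrite inE.
Qed.

End Transversal.

Lemma transversal_exists S e : claw indep S -> e \in E -> e \notin S ->
  exists2 R : {set T}, maxset (separated S) R & e \in R.
Proof.
move=> clS eE eS.
have sep : separated S [set e].
  apply/separatedP; rewrite sub1set inE eE eS; split=> // x y.
  by rewrite !inE => /eqP-> /eqP->.
by have [R mR sR] := maxset_exists sep; exists R; rewrite // -sub1set.
Qed.

Lemma separated0 S : separated S set0.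
Proof. by apply/separatedP; split; [exact: sub0set | move=> x y; rewrite inE]. Qed.

End Contract.

(** * The size of M_{r,t} *)

Definition Mrt_size r t := \sum_(i < t) (2 ^ Mrt_rank r t i - 1).

Lemma sum_ltn_ord m t : m <= t -> \sum_(i < t) (i < m : nat) = m.
Proof.
move=> le_mt; rewrite -big_mkcond /= -(big_ord_widen t (fun=> 1) le_mt).
by rewrite sum1_card card_ord.
Qed.

Lemma sum_Mrt_rank r t : 0 < t -> \sum_(i < t) Mrt_rank r t i = r.
Proof.
move=> t0; rewrite big_split /= sum_nat_const card_ord sum_ltn_ord ?(ltnW (ltn_pmod _ _)) //.
by rewrite mulnC -divn_eq.
Qed.

Lemma Mrt_sizeD r t : Mrt_size r t + t = \sum_(i < t) 2 ^ Mrt_rank r t i.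
Proof.
rewrite -[X in _ + X](card_ord t) -sum1_card -big_split; apply: eq_bigr => i _ /=.
by rewrite subnK // expn_gt0.
Qed.

(** Each geometry obeys [2 ^ n.+1 - 1 = 1 + 2 * (2 ^ n - 1)], and lowering [r] by [t] lowers each of
    the [t] ranks by one. *)
Lemma Mrt_size_rec r t : 0 < t -> t <= r -> Mrt_size r t = t + (Mrt_size (r - t) t).*2.
Proof.
move=> t0 le_tr.
have e : \sum_(i < t) 2 ^ Mrt_rank r t i = (\sum_(i < t) 2 ^ Mrt_rank (r - t) t i).*2.
  rewrite -mul2n big_distrr /=; apply: eq_bigr => i _; rewrite -expnS /Mrt_rank.
  by rewrite -{1 2}(subnK le_tr) divnDr ?dvdnn // divnn t0 modnDr; congr (2 ^ _); lia.
have := Mrt_sizeD r t; have := Mrt_sizeD (r - t) t; lia.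
Qed.

(* [2 ^ n] lies above the line through its values at [q] and [q + 1]. *)
Lemma expn_tangent q n : 2 ^ q + n * 2 ^ q <= 2 ^ n + q * 2 ^ q.
Proof.
have [le|lt] := leqP q n.
  have -> : n = (n - q) + q by lia.
  rewrite expnD; have := ltn_expl (n - q) (isT : 1 < 2); nia.
have : n.+1 * 2 ^ q <= q * 2 ^ q by rewrite leq_mul2r lt orbT.
lia.
Qed.

Lemma expn_tangent_eq q n : 2 ^ q + n * 2 ^ q = 2 ^ n + q * 2 ^ q -> n = q \/ n = q.+1.
Proof.
have q0 : 0 < 2 ^ q by rewrite expn_gt0.
have [le|lt] := leqP q n.
  have -> : n = (n - q) + q by lia.
  rewrite expnD; case: (n - q) => [|[|m]]; [by left | by right | ].
  by rewrite !expnS; have := ltn_expl m (isT : 1 < 2); nia.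
have : n.+1 * 2 ^ q <= q * 2 ^ q by rewrite leq_mul2r lt orbT.
have : 0 < 2 ^ n by rewrite expn_gt0.
lia.
Qed.

(** * Balanced ranks minimise the number of points *)

Section Convexity.
Variables (I : finType) (r t : nat) (n : I -> nat).
Hypotheses (t0 : 0 < t) (cardI : #|I| = t) (sum_n : r <= \sum_i n i).
Let q := r %/ t.

Let sumE : \sum_i (2 ^ n i - 1) + t = \sum_i 2 ^ n i.
Proof.
rewrite -[X in _ + X]cardI -sum1_card -big_split; apply: eq_bigr => i _ /=.
by rewrite subnK // expn_gt0.
Qed.

(** All ranks in [M_{r,t}] are [q] or [q.+1], where the tangent bound is an equality. The sum is
    written additively to avoid truncated subtraction. *)
Let MrtE : Mrt_size r t + t + t * (q * 2 ^ q) = t * 2 ^ q + r * 2 ^ q.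
Proof.
have sum_t c : t * c = \sum_(i < t) c by rewrite sum_nat_const card_ord.
rewrite Mrt_sizeD 2!sum_t -[in RHS](sum_Mrt_rank r t0) big_distrl -!big_split /=.
by apply: eq_bigr => i _; rewrite /Mrt_rank -/q; case: (_ < _); rewrite ?addn1 ?addn0 ?expnS; lia.
Qed.

Let tangentE : \sum_i (2 ^ q + n i * 2 ^ q) = t * 2 ^ q + (\sum_i n i) * 2 ^ q.
Proof. by rewrite big_split /= sum_nat_const cardI -big_distrl. Qed.

Let tangentE' : \sum_i (2 ^ n i + q * 2 ^ q) = \sum_i 2 ^ n i + t * (q * 2 ^ q).
Proof. by rewrite big_split /= sum_nat_const cardI. Qed.

Lemma Mrt_size_min : Mrt_size r t <= \sum_i (2 ^ n i - 1).
Proof.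
have : \sum_i (2 ^ q + n i * 2 ^ q) <= \sum_i (2 ^ n i + q * 2 ^ q).
  by apply: leq_sum => i _; apply: expn_tangent.
rewrite tangentE tangentE'; have := leq_mul2r (2 ^ q) r (\sum_i n i); rewrite sum_n orbT.
by move: MrtE sumE => *; lia.
Qed.

Hypothesis sum_le : \sum_i (2 ^ n i - 1) <= Mrt_size r t.

Lemma Mrt_size_min_sum : \sum_i n i = r.
Proof.
have : \sum_i (2 ^ q + n i * 2 ^ q) <= \sum_i (2 ^ n i + q * 2 ^ q).
  by apply: leq_sum => i _; apply: expn_tangent.
rewrite tangentE tangentE' => h.
have : (\sum_i n i) * 2 ^ q <= r * 2 ^ q by move: MrtE sumE h sum_le => *; lia.
by rewrite leq_mul2r expn_eq0 /= => ?; apply/eqP; rewrite eqn_leq sum_n andbT.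
Qed.

(** Equality of the sums forces equality in each single tangent bound. *)
Lemma Mrt_size_min_balanced i : n i = q \/ n i = q.+1.
Proof.
apply: expn_tangent_eq; apply/eqP.
have : forall i, xpredT i -> 2 ^ q + n i * 2 ^ q <= 2 ^ n i + q * 2 ^ q ?= iff
   (2 ^ q + n i * 2 ^ q == 2 ^ n i + q * 2 ^ q).
  by move=> j _; split=> //; apply: expn_tangent.
move/leqif_sum => [_]; rewrite tangentE tangentE' Mrt_size_min_sum.
have -> : t * 2 ^ q + r * 2 ^ q == \sum_i 2 ^ n i + t * (q * 2 ^ q).
  by apply/eqP; move: MrtE sumE sum_le Mrt_size_min => *; lia.
by move/esym/forallP/(_ i).
Qed.

(** Since the balanced [n i] add up to [r], exactly [r %% t] of them equal [q.+1]; listing those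
    indices first matches the order in [Mrt_rank]. *)
Lemma Mrt_size_min_bij : exists2 s : 'I_t -> I, bijective s & forall i, n (s i) = Mrt_rank r t i.
Proof.
pose A := [set i | n i == q.+1].
have nE i : n i = q + (i \in A).
  rewrite inE; have [->|->] := Mrt_size_min_balanced i; last by rewrite eqxx addn1.
  by rewrite ltn_eqF // addn0.
have cardA : #|A| = r %% t.
  have := Mrt_size_min_sum; rewrite (eq_bigr _ (fun i _ => nE i)) big_split /=.
  rewrite sum_nat_const cardI -big_mkcond sum1_card {1}(divn_eq r t) mulnC.
  by move/addnI; apply: etrans; apply: eq_card.
pose l := enum A ++ enum (~: A).
have sl : size l = t by rewrite size_cat -!cardE cardsC cardI.
have ul : uniq l.
  rewrite cat_uniq !enum_uniq andbT /=; apply/hasPn => x.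
  by rewrite !mem_enum inE.
have /card_gt0P[i0 _] : 0 < #|I| by rewrite cardI.
exists (fun i : 'I_t => nth i0 l i) => [|i].
  apply: inj_card_bij; last by rewrite card_ord cardI.
  move=> i j /eqP; rewrite nth_uniq ?sl // => /eqP; exact: val_inj.
rewrite nE /Mrt_rank -/q -cardA; congr (q + _); rewrite nth_cat -cardE.
case: ltnP => h; first by rewrite -mem_enum mem_nth // -cardE.
apply/eqP; rewrite eqb0 -in_setC -mem_enum mem_nth // -cardE.
by have := cardsC A; rewrite cardI; have := ltn_ord i; lia.
Qed.

End Convexity.

(** Padding the [k] ranks of [M_{r,k}] with [t - k] zeros changes neither sum nor size. If [t <= r]
    then [r %/ t] is positive, so a zero rank is not balanced and equality forces [k = t]. *)
Lemma Mrt_size_antitone r k t : 0 < k -> k <= t ->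
  Mrt_size r t <= Mrt_size r k /\ (t <= r -> Mrt_size r k <= Mrt_size r t -> k = t).
Proof.
move=> k0 le_kt; have t0 := leq_trans k0 le_kt.
pose m i := r %/ k + (i < r %% k).
pose n (i : 'I_t) := if i < k then m i else 0.
have sum_n : \sum_i n i = r.
  by rewrite -big_mkcond -(big_ord_widen t m le_kt) (sum_Mrt_rank r k0).
have size_n : \sum_i (2 ^ n i - 1) = Mrt_size r k.
  rewrite /Mrt_size (big_ord_widen t (fun i => 2 ^ m i - 1) le_kt) big_mkcond /=.
  by rewrite [RHS]big_mkcond; apply: eq_bigr => i _; rewrite /n; case: ifP.
have r_n : r <= \sum_i n i by rewrite sum_n.
split; first by rewrite -size_n; apply: Mrt_size_min; rewrite ?card_ord.
move=> le_tr; rewrite -size_n => le_n; apply/eqP; rewrite eqn_leq le_kt leqNgt.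
apply/negP => lt_kt.
have := Mrt_size_min_balanced t0 (card_ord t) r_n le_n (Ordinal lt_kt).
by rewrite /n /= ltnn; have := divn_gt0 r t0; rewrite le_tr; lia.
Qed.

Lemma card_PG n : #|{: PG_type n}| = 2 ^ n - 1.
Proof.
rewrite card_sig (eq_card (B := predC1 0%R)) // cardC1 card_mx card_Fp // mul1n; lia.
Qed.

Lemma card_Mrt_type r t : #|Mrt_type r t| = Mrt_size r t.
Proof.
rewrite card_tagged sumnE big_map big_enum /=.
by apply: eq_bigr => i _; rewrite card_PG.
Qed.

(** * The lower bound and extremal matroids *)

(** For [e] off a claw [S], such a [y] is a second point of the parallel class of [e] in M/S. *)
Definition partner (T : finType) (indep : {set T} -> bool) (S : {set T}) e y :=
  [/\ y \in nonloops indep, y \notin e |: S & y \in cl indep (e |: S)].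

Section Bound.
Variable T : finType.
Implicit Types (indep : {set T} -> bool) (S R X : {set T}).

Lemma partner_choice indep S R t : is_matroid indep -> claw indep S ->
  maxset (separated indep S) R -> noclaw indep t -> #|S| = t ->
  exists p : T -> T, {in R, forall x, partner indep S x (p x)}.
Proof.
move=> matM clS mR nc cS.
have : forall x : T, exists y, x \in R -> partner indep S x y.
  move=> x; have [xR|xR] := boolP (x \in R); last by exists x.
  have xE := transversal_nonloop mR xR; have xS := transversal_notin mR xR.
  by have [y ?] := claw_partner matM clS nc cS xE xS; exists y.
by case/fin_all_exists => p h; exists p => x /h.
Qed.

Lemma max_claw indep : is_matroid indep -> simple_on indep -> 0 < mrank indep setT ->
  exists S, [/\ claw indep S, 0 < #|S| & noclaw indep #|S|].
Proof.
move=> matM simpM r0; case: (arg_maxnP (fun S : {set T} => #|S|) (claw0 matM)) => S clS maxS.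
exists S; split=> //; have [e eE] := card_nonloops_rk matM r0.
by have := maxS _ (claw1 matM simpM eE); rewrite cards1.
Qed.

Lemma transversal_bound indep S R : is_matroid indep -> simple_on indep ->
  claw indep S -> noclaw indep #|S| -> maxset (separated indep S) R ->
  #|S| + #|R|.*2 <= #|nonloops indep|.
Proof.
move=> matM simpM clS nc mR; have [p hp] := partner_choice matM clS mR nc (erefl _).
rewrite -(card_partner matM clS mR hp) //.
by apply: subset_leq_card; apply: (partner_sub_nonloops matM clS mR hp).
Qed.

(** Induction on the rank, for all [t] at once: the contraction of a largest claw, of size [k], is
    bounded with [k] in place of [t]. *)
Lemma card_nonloops_bound indep r t : is_matroid indep -> simple_on indep ->
  mrank indep setT = r -> 0 < t -> noclaw indep t -> Mrt_size r t <= #|nonloops indep|.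
Proof.
have [m] := ubnP r; elim: m => // m IH in r t indep * => ltr matM simpM rM t0 nc.
have [r0|r0] := posnP r.
  by rewrite /Mrt_size big1 // => i _; rewrite r0 /Mrt_rank div0n mod0n.
have [|S [clS k0 ncS]] := max_claw matM simpM; first by rewrite rM.
have le_kt := nc _ clS.
have [R mR _] := maxset_exists (separated0 indep S).
have rC := contract_rank matM clS mR.
have le_kr : #|S| <= r by rewrite -rM -rC leq_addl.
apply: leq_trans (Mrt_size_antitone r k0 le_kt).1 _.
apply: leq_trans (transversal_bound matM simpM clS ncS mR).
rewrite Mrt_size_rec // leq_add2l leq_double -(nonloops_contract clS mR).
apply: IH => //; first by lia.
- exact: contract_matroid.
- exact: contract_simple.
- by rewrite -rM -rC addnK.
- exact: contract_noclaw.
Qed.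

(** Only the upper bound on the number of points is recorded; for positive [t],
    [card_nonloops_bound] supplies the reverse. *)
Definition extremal r t indep :=
  [/\ is_matroid indep, simple_on indep, mrank indep setT = r, noclaw indep t &
      #|nonloops indep| <= Mrt_size r t].

(** * Unique partners and exchange of claws in an extremal matroid *)

Section Extremal.
Variables (r t : nat) (indep : {set T} -> bool).
Hypotheses (t0 : 0 < t) (le_tr : t <= r) (ext : extremal r t indep).
Local Notation E := (nonloops indep).
Local Notation cl := (cl indep).

Let matM : is_matroid indep. Proof. by case: ext. Qed.
Let simpM : simple_on indep. Proof. by case: ext. Qed.
Let rM : mrank indep setT = r. Proof. by case: ext. Qed.
Let nc : noclaw indep t. Proof. by case: ext. Qed.
Let cE : #|E| <= Mrt_size r t. Proof. by case: ext. Qed.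

(** A largest claw of size [k < t] would force [Mrt_size r k] points, which is too many because
    [t <= r]. *)
Lemma extremal_claw : exists2 S, claw indep S & #|S| = t.
Proof.
have [|S [clS k0 ncS]] := max_claw matM simpM; first by rewrite rM (leq_trans t0).
exists S => //; apply: (Mrt_size_antitone r k0 (nc clS)).2 => //.
exact: leq_trans (card_nonloops_bound matM simpM rM k0 ncS) cE.
Qed.

Section Claw.
Variable S : {set T}.
Hypotheses (clS : claw indep S) (cS : #|S| = t).

Let ncS : noclaw indep #|S|. Proof. by rewrite cS. Qed.

(** The bounds on [#|E|] in terms of [#|R|] and on [#|R|] by [Mrt_size (r - t) t] compose to the
    extremal value, so both are tight. *)
Lemma extremal_contract R : maxset (separated indep S) R ->
  extremal (r - t) t (contract indep S R) /\ #|E| <= #|S| + #|R|.*2.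
Proof.
move=> mR; have mC := contract_matroid matM clS mR.
have sC := contract_simple matM clS mR.
have rC := contract_rank matM clS mR.
have nC := contract_noclaw matM simpM clS mR nc.
have {}rC : mrank (contract indep S R) setT = r - t by rewrite -rM -rC cS addnK.
have := card_nonloops_bound mC sC rC t0 nC.
have := transversal_bound matM simpM clS ncS mR.
have := Mrt_size_rec t0 le_tr; move: cE.
rewrite (nonloops_contract clS mR) cS => h1 h2 h3 h4; split; last by lia.
by split=> //; rewrite (nonloops_contract clS mR); lia.
Qed.

Lemma extremal_nonloops R p : maxset (separated indep S) R ->
  {in R, forall x, partner indep S x (p x)} -> S :|: R :|: p @: R = E.
Proof.
move=> mR hp; apply/eqP; rewrite eqEcard (partner_sub_nonloops matM clS mR hp).
by rewrite (card_partner matM clS mR hp) // (extremal_contract mR).2.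
Qed.

(** Choose partners with [p e = y]. They exhaust the points off [S :|: R], so [z] is some [p x];
    being parallel to [e], it has [x = e]. *)
Lemma partner_uniq e y z : e \in E -> e \notin S ->
  partner indep S e y -> partner indep S e z -> y = z.
Proof.
move=> eE eS py [zE zS zcl]; have [R mR eR] := transversal_exists clS eE eS.
have [p0 hp0] := partner_choice matM clS mR nc cS.
pose p x := if x == e then y else p0 x.
have hp : {in R, forall x, partner indep S x (p x)}.
  by move=> x xR; rewrite /p; case: eqP => [->|_] //; apply: hp0.
move: (zE); rewrite -(extremal_nonloops mR hp) !inE => /orP[/orP[h|zR]|/imsetP[x xR ez]].
- by move: zS; rewrite !inE h orbT.
- by move: zS; rewrite (transversal_inj mR eR zR zcl) setU11.
have : x = e by apply: (partner_cl matM clS mR hp) => //; rewrite -ez.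
by move=> ex; rewrite ez /p ex eqxx.
Qed.

Lemma partner_exists e : e \in E -> e \notin S -> exists y, partner indep S e y.
Proof. exact: (claw_partner matM clS nc cS). Qed.

(** By uniqueness, [y] is the only nonloop of [cl (e |: S)] off [e |: S], so it alone could spoil
    the claw property of [e |: A]. *)
Lemma claw_swap e y (A : {set T}) : e \in E -> e \notin S -> partner indep S e y ->
  A \subset S -> indep (y |: (e |: A)) -> claw indep (e |: A).
Proof.
move=> eE eS py sAS iA; have [yE yS ycl] := py.
have iS := indepU1_claw clS eE.
apply/andP; split; first by apply: (indep_sub matM) iA; rewrite subsetUr.
apply/forall_inP => f fE; have [->//|nfy] := eqVneq f y.
have [feS|feS] := boolP (f \in e |: S).
  by apply: (indep_sub matM) iS; rewrite subUset sub1set feS setUS.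
have : f \notin cl (e |: S).
  by apply: contra nfy => fcl; rewrite (partner_uniq eE eS py (z := f)).
rewrite -(indepU1 matM) // => h; apply: (indep_sub matM) h.
by rewrite !setUS.
Qed.

End Claw.

(** Extend [[set y; e]], with [y] the partner of [e], to a basis of [y |: (e |: S)]. It has [t.+1]
    points; dropping [y] leaves the claw. *)
Lemma claw_cover e : e \in E -> exists S, [/\ claw indep S, #|S| = t & e \in S].
Proof.
move=> eE; have [S clS cS] := extremal_claw.
have [eS|eS] := boolP (e \in S); first by exists S.
have [y py] := partner_exists clS cS eE eS; have [yE yS ycl] := py.
have iye := simpM yE eE; have iS := indepU1_claw clS eE.
have neye : y != e by apply: contra yS => /eqP->; rewrite setU11.
have sye : [set y; e] \subset y |: (e |: S).
  by rewrite setUA subsetUl.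
have [J [sJ1 sJ2 iJ cJ]] := basis_extend matM iye sye.
have {}cJ : #|J| = t.+1.
  rewrite cJ; move: ycl; rewrite inE => /eqP->.
  by apply/eqP; move: iS; rewrite (indepE matM) => /eqP->; rewrite cardsU1 eS cS.
pose A := J :\: [set y; e].
have JE : J = y |: (e |: A).
  by rewrite setUA -{1}(setID J [set y; e]) (setIidPr sJ1).
have sAS : A \subset S by rewrite subDset -setUA.
exists (e |: A); split; last by rewrite setU11.
  by apply: (claw_swap clS cS eE eS py) => //; rewrite -JE.
apply/eqP; rewrite -eqSS -cJ JE [X in _ == X]cardsU1 inE negb_or inE neye.
by rewrite !inE eqxx.
Qed.

End Extremal.
End Bound.

(** * Lines and the decomposition of extremal matroids *)

Definition third (T : finType) (indep : {set T} -> bool) e f g :=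
  [&& g \in nonloops indep, g \notin [set e; f] & g \in cl indep [set e; f]].

Definition adjacent (T : finType) (indep : {set T} -> bool) e f :=
  (e != f) && [exists g, third indep e f g].

Section Third.
Variables (T : finType) (indep : {set T} -> bool).
Hypotheses (matM : is_matroid indep) (simpM : simple_on indep).
Local Notation E := (nonloops indep).
Local Notation cl := (cl indep).
Local Notation third := (third indep).
Local Notation adj := (adjacent indep).

Lemma thirdC e f g : third e f g = third f e g.
Proof. by rewrite /third setUC. Qed.

Lemma third_rot e f g : e \in E -> f \in E -> e != f -> third e f g -> third e g f.
Proof.
move=> eE fE nef /and3P[gE + gcl]; rewrite !inE negb_or => /andP[nge ngf].
apply/and3P; split=> //; first by rewrite !inE negb_or eq_sym nef eq_sym ngf.
rewrite setUC.
apply: cl_exchange; rewrite // 1?setUC //.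
by apply: contra nge => /(simple_cl1 matM simpM gE eE) ->.
Qed.

Lemma adjacentC e f : adj e f = adj f e.
Proof.
by rewrite /adjacent eq_sym; congr (_ && _); apply: eq_existsb => g; rewrite thirdC.
Qed.

Lemma third_adjacent e f g : e \in E -> f \in E -> e != f -> third e f g -> adj e g.
Proof.
move=> eE fE nef h; have := h => /and3P[_ + _]; rewrite !inE negb_or eq_sym => /andP[neg _].
by rewrite /adjacent neg; apply/existsP; exists f; apply: third_rot.
Qed.

Section Claw.
Variable S : {set T}.
Hypothesis clS : claw indep S.

Let iS : indep S := claw_indep clS.

Lemma third_notin_claw s e g : s \in S -> e \in E -> e \notin S -> third s e g -> g \notin S.
Proof.
move=> sS eE eS /and3P[gE gse gcl]; apply: contraL gcl => gS.
rewrite -(indepU1 matM) //.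
  apply: (indep_sub matM) (indepU1_claw clS eE).
  by rewrite !subUset !sub1set !inE gS sS eqxx !orbT.
by apply: (indep_sub matM) (indepU1_claw clS eE); rewrite subUset !sub1set !inE sS eqxx !orbT.
Qed.

Lemma third_partner s e g : s \in S -> e \in E -> e \notin S -> third s e g -> partner indep S e g.
Proof.
move=> sS eE eS h; have gS := third_notin_claw sS eE eS h.
case/and3P: h => gE + gcl; rewrite !inE !negb_or => /andP[_ nge].
split=> //; first by rewrite !inE negb_or nge.
by apply: (cl_mono matM) gcl; rewrite subUset !sub1set !inE sS eqxx !orbT.
Qed.

(** A third point of the line would lie in [cl S], hence in [S], giving three collinear points in an
    independent set. *)
Lemma claw_nonadjacent s s' : s \in S -> s' \in S -> ~~ adj s s'.
Proof.
move=> sS sS'; apply/negP => /andP[_ /existsP[g /and3P[gE gss gcl]]].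
have ss : [set s; s'] \subset S by rewrite subUset !sub1set sS.
have gS : g \in S by case/(clawP matM): clS => _; apply; rewrite // (cl_mono matM ss).
have : g \notin cl [set s; s'].
  rewrite -(indepU1 matM) //; first by apply: (indep_sub matM) iS; rewrite subUset sub1set gS.
  exact: (indep_sub matM ss).
by rewrite gcl.
Qed.

End Claw.
End Third.

(** * Three-point lines and their classes when [2 * t <= r] *)

Section Line.
Variables (T : finType) (indep : {set T} -> bool) (r t : nat).
Hypotheses (t0 : 0 < t) (le_tr : 2 * t <= r) (ext : extremal r t indep).
Implicit Types (S : {set T}).
Local Notation E := (nonloops indep).
Local Notation cl := (cl indep).
Local Notation third := (third indep).
Local Notation adj := (adjacent indep).

Let matM : is_matroid indep. Proof. by case: ext. Qed.
Let simpM : simple_on indep. Proof. by case: ext. Qed.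
Let nc : noclaw indep t. Proof. by case: ext. Qed.
Let le_t : t <= r. Proof. by lia. Qed.

(** A [t]-claw [X] of the contraction through [e] is also a claw of M, and [X :|: S] is independent,
    so partners over [S] and over [X] can be compared. *)
Lemma partner_line S e y : claw indep S -> #|S| = t -> e \in E -> e \notin S ->
  partner indep S e y -> exists2 s, s \in S & third s e y.
Proof.
move=> clS cS eE eS py.
have [R mR eR] := transversal_exists clS eE eS.
have [p hp] := partner_choice matM clS mR nc cS.
have {y py} -> : y = p e by apply: (partner_uniq t0 le_t ext clS cS eE eS) => //; apply: hp.
have [extC _] := extremal_contract t0 le_t ext clS cS mR.
(* The contraction has rank [r - t]; this inequality provides a [t]-claw of it through [e]. *)
have le_t' : t <= r - t by lia.
have := claw_cover t0 le_t' extC; rewrite (nonloops_contract clS mR) => /(_ _ eR) [X [clC cX eX]].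
have clX := contract_claw matM simpM clS mR clC.
have /andP[/andP[sXR iXS] /forall_inP clC'] := clC.
have iX := claw_indep clX.
have dXS x : x \in X -> x \notin S by move/(subsetP sXR)/(transversal_notin mR).
have addX z s : s \in S -> z \notin s |: X -> indep (z |: X :|: S) -> z \notin cl (s |: X).
  move=> sS zsX h; rewrite -(indepU1 matM) //.
    by apply: (indep_sub matM) h; rewrite !subUset !sub1set !inE eqxx sS !orbT
       -setUA subsetU // subsetUl orbT.
  by apply: (indep_sub matM) iXS; rewrite subUset sub1set inE sS orbT subsetUl.
(* The partner [z] of [s] over [X] is in neither [S] nor [R], since adding such a point keeps
   [X :|: S] independent. If [z = p x] with [x] off [X], then [x] lies in [cl (X :|: S)], though [X]
   is a claw of the contraction. *)
have partnerX s z : s \in S -> partner indep X s z -> z \in p @: X.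
  move=> sS [zE zsX zcl].
  move: (zE); rewrite -(extremal_nonloops t0 le_t ext clS cS mR hp) !inE -orbA => /or3P[zS|zR|].
  - suff : z \notin cl (s |: X) by rewrite zcl.
    by apply: addX => //; apply: (indep_sub matM) iXS;
       rewrite !subUset sub1set subsetUl subsetUr inE zS orbT.
  - suff : z \notin cl (s |: X) by rewrite zcl.
    apply: addX => //; have := clC' z; rewrite (nonloops_contract clS mR) => /(_ zR).
    by case/andP.
  case/imsetP => x xR ez; have [xX|xX] := boolP (x \in X).
    by rewrite ez imset_f.
  have [pE pS pcl] := hp x xR.
  have xcl : x \in cl (z |: S).
    apply: cl_exchange; rewrite ?ez // (claw_notin_cl matM clS) //.
    by apply: contra pS => /setU1r.
  have xXS : x \in cl (X :|: S).
    apply: (cl_trans matM (Y := z |: S)) xcl.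
    rewrite subUset sub1set (subset_trans _ (sub_cl _ _)) ?subsetUr // andbT.
    by apply: (cl_mono matM) zcl; rewrite subUset sub1set inE sS orbT subsetUl.
  have := clC' x; rewrite (nonloops_contract clS mR) => /(_ xR) /andP[_]; rewrite -setUA.
  by rewrite (indepU1 matM) ?xXS // inE negb_or xX (transversal_notin mR).
have [q hq] : exists q : T -> T, forall s, s \in S -> partner indep X s (q s).
  have : forall s, exists z, s \in S -> partner indep X s z.
    move=> s; have [sS|sS] := boolP (s \in S); last by exists s.
    have sE := nonloopsP matM (claw_indep clS) sS.
    have sX : s \notin X by apply: contraL sS; apply: dXS.
    by have [z ?] := partner_exists ext clX cX sE sX; exists z.
  by case/fin_all_exists => q h; exists q.
(* Each [s] in [S] has its partner over the claw [X] among the points [p x], [x] in [X]; as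
   [#|S| = #|X|] this exhausts them, so [p e] lies in cl (s |: X) and cl (e |: S), which meet
   in the line through [s] and [e]. *)
have qinj : {in S &, injective q}.
  move=> s s' sS sS' eqs; apply/eqP; apply/negPn/negP => ness.
  have [qE qsX qcl] := hq s sS; have [_ _] := hq s' sS'; rewrite -eqs => qcl'.
  have qX : q s \in cl ((s |: X) :&: (s' |: X)).
    apply: (cl_inter matM) => //; apply: (indep_sub matM) iXS.
    by rewrite !subUset !sub1set !inE sS sS' subsetUl !orbT.
  have eX' : (s |: X) :&: (s' |: X) = X.
    apply/setP => x; rewrite !inE; case: (boolP (x \in X)); rewrite ?orbT // !orbF.
    by move=> _; apply/negP => /andP[/eqP-> /eqP es]; rewrite es eqxx in ness.
  rewrite eX' in qX; have : q s \in X by case/(clawP matM): clX => _; apply.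
  by move=> h; rewrite !inE h orbT in qsX.
have eqp : q @: S = p @: X.
  apply/eqP; rewrite eqEcard (card_in_imset qinj) cS -cX leq_imset_card andbT.
  by apply/subsetP => _ /imsetP[s sS ->]; exact: (partnerX s _ sS (hq s sS)).
have : p e \in q @: S by rewrite eqp imset_f.
case/imsetP => s sS ep; exists s => //.
have [pE pS pcl] := hp e eR; have [_ _ pcl'] := hq s sS; rewrite -ep in pcl'.
have : p e \in cl ((s |: X) :&: (e |: S)).
  apply: (cl_inter matM) => //; apply: (indep_sub matM) iXS.
  by rewrite !subUset !sub1set !inE sS eX subsetUl subsetUr !orbT.
have -> : (s |: X) :&: (e |: S) = [set s; e].
  apply/setP => x; rewrite !inE; have [->|_] := eqVneq x s; first by rewrite sS orbT.
  have [->|_] := eqVneq x e; first by rewrite eX.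
  by apply/negP => /andP[/dXS/negPf->].
move=> h; apply/and3P; split; rewrite // !inE negb_or.
by move: pS; rewrite !inE negb_or => /andP[-> pS]; rewrite andbT; apply: contra pS => /eqP->.
Qed.

Lemma adjacent_claw S e : claw indep S -> #|S| = t -> e \in E -> e \notin S ->
  exists2 s, s \in S & adj s e.
Proof.
move=> clS cS eE eS; have [y py] := partner_exists ext clS cS eE eS.
have [s sS h] := partner_line clS cS eE eS py; exists s => //.
apply/andP; split; first by apply: contraNneq eS => <-.
by apply/existsP; exists y.
Qed.

(** Partners are unique, so both lines have the same third point. For [s != s'] the lines share only
    [e]. *)
Lemma adjacent_claw_uniq S e s s' : claw indep S -> #|S| = t -> e \in E -> e \notin S ->
  s \in S -> s' \in S -> adj s e -> adj s' e -> s = s'.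
Proof.
move=> clS cS eE eS sS sS' /andP[_ /existsP[y hy]] /andP[_ /existsP[z hz]].
have yz : y = z.
  apply: (partner_uniq t0 le_t ext clS cS eE eS).
    exact: third_partner hy.
  exact: third_partner hz.
apply/eqP/negPn/negP => ness.
have : y \in cl ([set s; e] :&: [set s'; e]).
  apply: (cl_inter matM); last by rewrite yz; case/and3P: hz.
    apply: (indep_sub matM) (indepU1_claw clS eE).
    by rewrite !subUset !sub1set !inE sS sS' eqxx !orbT.
  by case/and3P: hy.
have -> : [set s; e] :&: [set s'; e] = [set e].
  apply/setP => x; rewrite !inE; case: (x == e); rewrite ?orbT // !orbF.
  by apply/negP => /andP[/eqP-> /eqP es]; rewrite es eqxx in ness.
case/and3P: hy => yE + _ ycl; rewrite !inE negb_or => /andP[_ /eqP]; apply.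
exact: (simple_cl1 matM simpM).
Qed.

(** For [s] running over a [t]-claw, these sets will be the summands. *)
Definition class s := [set e in E | (e == s) || adj s e].

Lemma mem_class s e : (e \in class s) = (e \in E) && ((e == s) || adj s e).
Proof. by rewrite in_set. Qed.

(** For [e] off [S] with partner [y], the point [s] is on the line through [e] and [y]. Hence
    [y |: (e |: S :\ s)] spans the independent set [e |: S], is no larger, and so is independent, as
    the exchange requires. *)
Lemma class_swap S s e : claw indep S -> #|S| = t -> s \in S -> e \in class s ->
  claw indep (e |: S :\ s) /\ #|e |: S :\ s| = t.
Proof.
move=> clS cS sS; rewrite mem_class => /andP[eE /orP[/eqP->|]]; first by rewrite setD1K.
have [eS|eS] := boolP (e \in S); first by rewrite (negPf (claw_nonadjacent matM clS sS eS)).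
move=> /andP[nse /existsP[y hy]]; split; last first.
  by rewrite cardsU1 !inE (negPf eS) andbF add1n -cS (cardsD1 s S) sS.
have sE := nonloopsP matM (claw_indep clS) sS.
apply: (claw_swap t0 le_t ext clS cS eE eS (third_partner matM clS sS eE eS hy) (subD1set _ _)).
apply: (indep_span matM (indepU1_claw clS eE)).
  apply/subsetP => x /setU1P[->|xS]; first by apply: mem_cl; rewrite !inE eqxx orbT.
  have [->|nxs] := eqVneq x s; last by apply: mem_cl; rewrite !inE nxs xS !orbT.
  have : third e y s by apply: third_rot; rewrite // 1?eq_sym // thirdC.
  by case/and3P => _ _; apply: (cl_mono matM); rewrite subUset !sub1set !inE !eqxx !orbT.
rewrite (leq_trans (leq_card_setU _ _)) // cards1 !cardsU1 !inE (negPf eS) andbF /=.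
by rewrite (cardsD1 s S) sS.
Qed.

Section Classes.
Variable S : {set T}.
Hypotheses (clS : claw indep S) (cS : #|S| = t).

Lemma class_claw s s' : s' \in S -> s \in S -> s' \in class s -> s' = s.
Proof.
move=> sS' sS; rewrite mem_class => /andP[_ /orP[/eqP//|]].
by rewrite (negPf (claw_nonadjacent matM clS sS sS')).
Qed.

Lemma class_cover e : e \in E -> exists2 s, s \in S & e \in class s.
Proof.
move=> eE; have [eS|eS] := boolP (e \in S); first by exists e; rewrite // mem_class eE eqxx.
have [s sS h] := adjacent_claw clS cS eE eS; exists s => //.
by rewrite mem_class eE h orbT.
Qed.

Lemma class_uniq e s s' : s \in S -> s' \in S -> e \in class s -> e \in class s' -> s = s'.
Proof.
move=> sS sS' es es'; have [eS|eS] := boolP (e \in S).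
  by rewrite -(class_claw eS sS es) (class_claw eS sS' es').
move: es es'; rewrite !mem_class => /andP[eE es] /andP[_ es'].
apply: (adjacent_claw_uniq clS cS eE eS) => //.
  by case/orP: es => // /eqP ees; rewrite -ees (negPf eS) in sS.
by case/orP: es' => // /eqP ees; rewrite -ees (negPf eS) in sS'.
Qed.

(** Replace [s] by [e] in the claw. Then [f] is adjacent to a member of the new claw, which must be
    [e], since any other would put [f] in a second class. *)
Lemma class_third s e f : s \in S -> e \in class s -> f \in class s -> e != f ->
  exists2 g, g \in class s & third e f g.
Proof.
move=> sS es fs nef; have [clS' cS'] := class_swap clS cS sS es.
have eE : e \in E by move: es; rewrite mem_class => /andP[].
have fE : f \in E by move: fs; rewrite mem_class => /andP[].
have fS' : f \notin e |: S :\ s.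
  rewrite !inE negb_or eq_sym nef /= negb_and negbK; case: (boolP (f \in S)) => fS; rewrite ?orbT //.
  by rewrite (class_claw fS sS fs) eqxx.
have [s' /setU1P[->|]] := adjacent_claw clS' cS' fE fS'; last first.
  rewrite !inE => /andP[nss sS'] h; case/eqP: nss.
  by apply: class_uniq fs => //; rewrite mem_class fE h orbT.
case/andP=> _ /existsP[g hg]; exists g => //.
have gE : g \in E by case/and3P: hg.
have [s1 sS' gs'] := class_cover gE.
(* In another class [s1], the point [g] would be adjacent to both [s1] and [e] in the new claw, or
   would itself be [s1]. *)
have [<-//|nss] := eqVneq s1 s.
have eg := third_adjacent matM simpM eE fE nef hg.
have gS' : g \notin e |: S :\ s.
  rewrite !inE negb_or eq_sym; case/andP: (eg) => -> _ /=; apply/negP => /andP[ngs gS].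
  case/eqP: ngs; apply: (class_uniq (e := e)) => //.
  by rewrite mem_class eE adjacentC eg orbT.
have : s1 = e; last first.
  by move=> es'; case/eqP: nss; rewrite es' in sS' *; apply: class_claw.
apply: (adjacent_claw_uniq clS' cS' gE gS'); rewrite ?setU11 ?inE ?nss ?sS' ?orbT //.
move: gs'; rewrite mem_class gE /= => /orP[/eqP gs'|//].
by move: gS'; rewrite gs' !inE nss sS' orbT.
Qed.

End Classes.
End Line.

(** * Restrictions, covers by flat pieces, and the direct sum decomposition *)

Definition restriction (T : finType) (indep : {set T} -> bool) (A X : {set T}) :=
  (X \subset A) && indep X.

Lemma Mrt_size1 n : Mrt_size n 1 = 2 ^ n - 1.
Proof. by rewrite /Mrt_size big_ord1 /Mrt_rank divn1 modn1 addn0. Qed.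

Section Restriction.
Variables (T : finType) (indep : {set T} -> bool).
Hypotheses (matM : is_matroid indep) (simpM : simple_on indep).
Implicit Types (X : {set T}).
Local Notation E := (nonloops indep).
Local Notation rk := (mrank indep).

(** Take the union of bases of the [P i] extending the traces of [X]; it spans because the [P i]
    cover the nonloops. *)
Lemma cover_basis (I : finType) (P : I -> {set T}) (X : {set T}) :
  E \subset \bigcup_i P i -> X \subset E -> (forall i, indep (X :&: P i)) ->
  exists J : {set T}, [/\ X \subset J, setT \subset cl indep J & #|J| <= \sum_i rk (P i)].
Proof.
move=> sEP sXE iX.
have : forall i, exists J : {set T}, [/\ X :&: P i \subset J, J \subset P i, indep J & #|J| = rk (P i)].
  by move=> i; apply: (basis_extend matM (iX i) (subsetIr _ _)).
case/fin_all_exists => J hJ; exists (\bigcup_i J i); split.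
- apply/subsetP => x xX; case/bigcupP: (subsetP sEP x (subsetP sXE x xX)) => i _ xi.
  apply/bigcupP; exists i => //; have [/subsetP sJ _ _ _] := hJ i.
  by apply: sJ; rewrite inE xX.
- apply/subsetP => x _; have [xE|xE] := boolP (x \in E); last exact: notin_nonloops.
  case/bigcupP: (subsetP sEP x xE) => i _ xi; have [_ sJP iJ cJ] := hJ i.
  apply: (cl_mono matM (X := J i)); first exact: bigcup_sup.
  rewrite inE eqn_leq [X in _ && X](rk_sub matM (subsetUr _ _)) andbT.
  rewrite [X in _ <= X](_ : _ = rk (P i)); last first.
    by apply/eqP; rewrite -cJ -(indepE matM).
  by rewrite rk_sub // subUset sub1set xi.
apply: leq_trans (_ : \sum_i #|J i| <= _); last by apply: leq_sum => i _; case: (hJ i) => _ _ _ ->.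
elim/big_rec2: _ => [|i n A _ le]; first by rewrite cards0.
by rewrite (leq_trans (leq_card_setU _ _)) // leq_add2l.
Qed.

Lemma rk_cover (I : finType) (P : I -> {set T}) :
  E \subset \bigcup_i P i -> rk setT <= \sum_i rk (P i).
Proof.
move=> sEP; have [i|J [_ sJ cJ]] := cover_basis sEP (sub0set _).
  by rewrite set0I indep0.
apply: leq_trans cJ; rewrite -(setUT J) (rk_clU matM sJ).
exact: rk_leq_card.
Qed.

(** When the ranks add up to the full rank, the spanning set of [cover_basis] is small enough to be
    a basis. *)
Lemma indep_cover (I : finType) (P : I -> {set T}) (X : {set T}) :
  E \subset \bigcup_i P i -> \sum_i rk (P i) = rk setT -> X \subset E ->
  indep X = [forall i, indep (X :&: P i)].
Proof.
move=> sEP eP sXE; apply/idP/forallP => [iX i|iX].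
  by apply: (indep_sub matM) iX; rewrite subsetIl.
have [J [sXJ sJ cJ]] := cover_basis sEP sXE iX; apply: (indep_sub matM sXJ).
rewrite (indepE matM) eqn_leq rk_leq_card //=.
by rewrite -(rk_clU matM sJ) setUT -eP.
Qed.

Variable A : {set T}.
Hypothesis sAE : A \subset E.
Local Notation rindep := (restriction indep A).

Lemma restriction_matroid : is_matroid rindep.
Proof.
case: (matM) => _ _ aug; split=> [|B C sCB /andP[sBA iB]|B C /andP[sBA iB] /andP[sCA iC] /(aug _ _ iB iC)].
- by rewrite /restriction sub0set indep0.
- by rewrite /restriction (subset_trans sCB) //; apply: (indep_sub matM sCB).
case=> x xCB ix; exists x => //; rewrite /restriction ix andbT subUset sub1set sBA andbT.
by move: xCB; rewrite inE => /andP[_ /(subsetP sCA)].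
Qed.

Lemma nonloops_restriction : nonloops rindep = A.
Proof.
apply/setP => x; rewrite inE /restriction sub1set; case: (boolP (x \in A)) => //= /(subsetP sAE).
by rewrite inE.
Qed.

Lemma restriction_simple : simple_on rindep.
Proof.
move=> e f; rewrite nonloops_restriction => eA fA.
by rewrite /restriction subUset !sub1set eA fA simpM ?(subsetP sAE).
Qed.

Lemma rk_restriction X : mrank rindep X = rk (X :&: A).
Proof. by apply: eq_bigl => Y; rewrite /restriction subsetI andbA. Qed.

Lemma cl_restriction X e : X \subset A -> e \in A -> (e \in cl rindep X) = (e \in cl indep X).
Proof.
move=> sXA eA; rewrite !inE !rk_restriction (setIidPl sXA) (setIidPl _) //.
by rewrite subUset sub1set eA.
Qed.

(** Two points of a claw form a claw, whose closure cannot contain a third point of their line. *)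
Lemma restriction_noclaw :
  (forall e f, e \in A -> f \in A -> e != f -> exists2 g, g \in A & third indep e f g) ->
  noclaw rindep 1.
Proof.
move=> lineA X clX; rewrite leqNgt; apply/negP => /card_gt1P[e [f [eX fX nef]]].
have mR := restriction_matroid.
have sXA : X \subset A by case/andP: (claw_indep clX).
have sef : [set e; f] \subset X by rewrite subUset !sub1set eX.
have := claw_sub mR sef clX => /(clawP mR)[_]; rewrite nonloops_restriction.
have [eA fA] := (subsetP sXA e eX, subsetP sXA f fX).
have [g gA /and3P[_ gef gcl]] := lineA e f eA fA nef.
move=> /(_ g gA); rewrite cl_restriction // ?(subset_trans sef) // => /(_ gcl).
by rewrite (negPf gef).
Qed.

End Restriction.

Lemma extremal_decomposition (T : finType) (indep : {set T} -> bool) r t :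
  0 < t -> 2 * t <= r -> extremal r t indep ->
  exists P : 'I_t -> {set T},
  [/\ \bigcup_i P i = nonloops indep,
      forall i j x, x \in P i -> x \in P j -> i = j,
      forall i, extremal (Mrt_rank r t i) 1 (restriction indep (P i)) &
      forall X : {set T}, X \subset nonloops indep -> indep X = [forall i, indep (X :&: P i)]].
Proof.
move=> t0 le_t ext; have [matM simpM rM nc cE] := ext.
have le_tr : t <= r by lia.
have [S clS cS] := extremal_claw t0 le_tr ext.
pose Q (i : 'I_#|S|) := class indep (enum_val i).
have QE : \bigcup_i Q i = nonloops indep.
  apply/eqP; rewrite eqEsubset; apply/andP; split; apply/subsetP => x.
    by case/bigcupP => i _; rewrite mem_class => /andP[].
  move/(class_cover t0 le_t ext clS cS) => [s sS xs]; apply/bigcupP.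
  by exists (enum_rank_in sS s); rewrite // /Q enum_rankK_in.
have Q_disj i j x : x \in Q i -> x \in Q j -> i = j.
  move=> xi xj; apply: enum_val_inj.
  by apply: (class_uniq t0 le_t ext clS cS) xi xj; apply: enum_valP.
have QsE i : Q i \subset nonloops indep by rewrite -QE bigcup_sup.
have ncQ i : noclaw (restriction indep (Q i)) 1.
  apply: restriction_noclaw => // e f eQ fQ nef.
  exact: (class_third t0 le_t ext clS cS (enum_valP i)).
pose n i := mrank indep (Q i).
have rQ i : mrank (restriction indep (Q i)) setT = n i by rewrite rk_restriction setTI.
have cardQ i : 2 ^ n i - 1 <= #|Q i|.
  rewrite -Mrt_size1 -(nonloops_restriction (QsE i)).
  apply: card_nonloops_bound => //; first exact: restriction_matroid.
  exact: restriction_simple.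
have sumQ : \sum_i #|Q i| = #|nonloops indep|.
  rewrite -QE -[RHS]sum1_card partition_disjoint_bigcup /=.
    by apply: eq_bigr => i _; rewrite sum1_card.
  move=> i j nij; apply/pred0P => x /=; apply/negP => /andP[xi xj].
  by rewrite (Q_disj i j x xi xj) eqxx in nij.
have cI : #|'I_#|S| | = t by rewrite card_ord.
have r_n : r <= \sum_i n i by rewrite -rM; apply: rk_cover; rewrite // QE.
have le_n : \sum_i (2 ^ n i - 1) <= Mrt_size r t.
  apply: leq_trans cE; rewrite -sumQ; exact: leq_sum.
have sum_n := Mrt_size_min_sum t0 cI r_n le_n.
have [s bij_s ns] := Mrt_size_min_bij t0 cI r_n le_n.
(* The lower bounds [2 ^ n i - 1] add up to at least [Mrt_size r t], hence to at least the number of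
   points, so each is attained. *)
have card_eq i : #|Q i| = 2 ^ n i - 1.
  have leifQ j : xpredT j -> 2 ^ n j - 1 <= #|Q j| ?= iff (2 ^ n j - 1 == #|Q j|).
    by move=> _; split.
  have [_] := leqif_sum leifQ; rewrite sumQ eqn_leq -{1}sumQ leq_sum //=.
  rewrite (leq_trans cE) ?Mrt_size_min //.
  by move/esym/forallP/(_ i)/eqP.
exists (Q \o s); split.
- by rewrite -QE [RHS](reindex s) //; apply: onW_bij.
- by move=> i j x xi xj; apply: (bij_inj bij_s); apply: Q_disj xi xj.
- move=> i; rewrite -ns; split; rewrite /comp.
  + exact: restriction_matroid.
  + exact: restriction_simple.
  + exact: rQ.
  + exact: ncQ.
  + by rewrite nonloops_restriction // card_eq Mrt_size1.
move=> X sXE; rewrite (indep_cover matM (P := Q)) ?QE ?rM //.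
apply/forallP/forallP => h i; first exact: h.
by case: bij_s => s' _ s's; rewrite -(s's i); apply: h.
Qed.

(** * Coordinates for a matroid without 2-claws *)

(** Lets linear relations carry coefficients indexed by points instead of positions in a
    sequence. *)
Lemma free_enumP (K : fieldType) (V : vectType K) (T : finType) (X : {set T}) (phi : T -> V) :
  reflect (forall k : T -> K, (\sum_(x in X) k x *: phi x)%R = 0%R -> forall x, x \in X -> k x = 0%R)
    (free [seq phi x | x <- enum X]).
Proof.
pose u := [tuple phi (enum_val i) | i < #|X|].
have -> : [seq phi x | x <- enum X] = u.
  have sX : size [seq phi x | x <- enum X] = #|X| by rewrite size_map cardE.
  apply: (@eq_from_nth _ 0%R) => [|i]; rewrite sX ?size_tuple // => ltiX; rewrite -[i]/(nat_of_ord (Ordinal ltiX)) -[RHS]tnth_nth tnth_mktuple.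
  have x0 := enum_val (Ordinal ltiX).
  by rewrite (enum_val_nth x0) (nth_map x0) // -cardE.
have uE (k : T -> K) : (\sum_(i < #|X|) k (enum_val i) *: u`_i = \sum_(x in X) k x *: phi x)%R.
  rewrite [RHS]big_enum_val; apply: eq_bigr => i _.
  by rewrite -tnth_nth tnth_mktuple.
apply: (iffP freeP) => h k hk.
  move=> x xX; rewrite -(enum_rankK_in xX xX); apply: (h (fun i => k (enum_val i))).
  by rewrite uE.
(* The sum has at most one term, as [enum_val] is injective; it extends [k] by zero off [X]. *)
pose k' x := (\sum_(i < #|X| | enum_val i == x) k i)%R.
have k'E i : k' (enum_val i) = k i.
  by rewrite /k' (big_pred1 i) // => j; rewrite (inj_eq enum_val_inj).
move=> i; rewrite -k'E; apply: h (enum_valP i); rewrite -uE -[RHS]hk.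
by apply: eq_bigr => j _; rewrite k'E.
Qed.

Lemma addrr_F2 (x : 'F_2) : (x + x = 0)%R.
Proof. by case: x => [[|[|//]]] ?; apply: val_inj. Qed.

Lemma F2_cases (x : 'F_2) : x = 0%R \/ x = 1%R.
Proof. by case: x => [[|[|//]]] ?; [left | right]; apply: val_inj. Qed.

Lemma addrr_row n (u : 'rV['F_2]_n) : (u + u = 0)%R.
Proof. by apply/rowP => i; rewrite !mxE addrr_F2. Qed.

Section Geometry.
Variables (T : finType) (indep : {set T} -> bool) (n : nat).
Hypotheses (n0 : 0 < n) (ext : extremal n 1 indep).
Implicit Types (X B C Y : {set T}).
Local Notation E := (nonloops indep).
Local Notation cl := (cl indep).
Local Notation third := (third indep).

Let matM : is_matroid indep. Proof. by case: ext. Qed.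
Let simpM : simple_on indep. Proof. by case: ext. Qed.
Let rM : mrank indep setT = n. Proof. by case: ext. Qed.
Let cE : #|E| <= 2 ^ n - 1. Proof. by case: ext; rewrite Mrt_size1. Qed.

(** A single point is here a claw of the largest size, so third points are partners over it;
    existence and uniqueness carry over. *)
Lemma third_exists e f : e \in E -> f \in E -> e != f -> exists g, third e f g.
Proof.
move=> eE fE nef; have fe : f \notin [set e] by rewrite inE eq_sym.
have [y [yE ye ycl]] := partner_exists ext (claw1 matM simpM eE) (cards1 e) fE fe.
by exists y; apply/and3P; rewrite setUC.
Qed.

Lemma third_uniq e f g h : e \in E -> f \in E -> e != f -> third e f g -> third e f h -> g = h.
Proof.
move=> eE fE nef /and3P[gE ge gcl] /and3P[hE he hcl].
have fe : f \notin [set e] by rewrite inE eq_sym.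
by apply: (partner_uniq (ltn0Sn 0) n0 ext (claw1 matM simpM eE) (cards1 e) fE fe); split;
  rewrite // setUC.
Qed.

Lemma third_cl e f g X : third e f g -> e \in cl X -> f \in cl X -> g \in cl X.
Proof.
case/and3P=> _ _ gcl eX fX; apply: (cl_trans matM) gcl.
by rewrite subUset !sub1set eX.
Qed.

Lemma third_neq e f g : third e f g -> (e != g) && (f != g).
Proof. by case/and3P=> _; rewrite !inE negb_or ![g == _]eq_sym. Qed.

(* If A is the hyperplane, joining [e] to its points gives |A| + 1 points off A; since
   |A| >= 2^(n-1) - 1 and |E| <= 2^n - 1 these are all, so [f] is on a line through [e] and A. *)
Lemma hyperplane_third B b e f g : indep B -> #|B| = n -> b \in B ->
  e \in E -> f \in E -> e != f -> third e f g ->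
  e \notin cl (B :\ b) -> f \notin cl (B :\ b) -> g \in cl (B :\ b).
Proof.
move=> iB cB bB eE fE nef efg eH fH.
pose A := E :&: cl (B :\ b).
have sAE : A \subset E by rewrite subsetIl.
have thirdA x y z : x \in A -> y \in A -> third x y z -> z \in A.
  rewrite !in_setI => /andP[xE xH] /andP[yE yH] xyz.
  by rewrite (third_cl xyz) // andbT; case/and3P: xyz.
have rA : mrank (restriction indep A) setT = n.-1.
  have iBb : indep (B :\ b) by apply: (indep_sub matM) iB; rewrite subD1set.
  rewrite rk_restriction setTI -(setUidPr (_ : B :\ b \subset A)).
    rewrite rk_clU ?subsetIr //.
    by move: iBb; rewrite (indepE matM) => /eqP->; rewrite -cB (cardsD1 b B) bB.
  by rewrite subsetI sub_cl andbT; apply/subsetP => x xB; apply: (nonloopsP matM iBb).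
have cA : 2 ^ n.-1 - 1 <= #|A|.
  rewrite -Mrt_size1 -(nonloops_restriction sAE).
  apply: card_nonloops_bound => //; first exact: restriction_matroid.
    exact: restriction_simple.
  apply: restriction_noclaw => // x y xA yA nxy.
  have [z xyz] := third_exists (subsetP sAE x xA) (subsetP sAE y yA) nxy.
  by exists z => //; apply: thirdA xyz.
have neA x : x \in A -> e != x.
  by rewrite in_setI => /andP[_ xH]; apply: contraNneq eH => ->.
have [q hq] : exists q : T -> T, forall x, x \in A -> third e x (q x).
  have : forall x, exists y, x \in A -> third e x y.
    move=> x; have [xA|xA] := boolP (x \in A); last by exists x.
    by have [y exy] := third_exists eE (subsetP sAE x xA) (neA x xA); exists y.
  by case/fin_all_exists => q h; exists q.
have hq' x : x \in A -> [/\ q x \in E, e != q x & third e (q x) x].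
  move=> xA; have exq := hq x xA; have /andP[neq _] := third_neq exq.
  by split=> //; [case/and3P: exq | apply: (third_rot matM simpM eE (subsetP sAE x xA) (neA x xA))].
have q_inj : {in A &, injective q}.
  move=> x y xA yA eqxy; have [qE neq exq] := hq' x xA; have [_ _ eyq] := hq' y yA.
  by apply: (third_uniq eE qE neq) => //; rewrite eqxy.
have sub : e |: q @: A \subset E :\: A.
  apply/subsetP => y /setU1P[->|/imsetP[x xA ->]].
    by rewrite in_setD in_setI eE (negPf eH).
  have [qE neq exq] := hq' x xA; rewrite in_setD in_setI qE andbT /=.
  apply: contra eH => qH; move: (xA); rewrite in_setI => /andP[xE xH].
  apply: (third_cl (e := x) (f := q x)) => //.
  by rewrite thirdC; apply: third_rot; rewrite // 1?eq_sym // thirdC.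
have eA : e |: q @: A = E :\: A.
  apply/eqP; rewrite eqEcard sub cardsU1 (card_in_imset q_inj) cardsD (setIidPr sAE).
  have -> : e \notin q @: A.
    by apply/imsetP => -[x xA ex]; have [_] := hq' x xA; rewrite -ex eqxx.
  by move: cA cE; rewrite -{2}(prednK n0) expnS /=; lia.
have : f \in e |: q @: A by rewrite eA in_setD in_setI fE (negPf fH).
case/setU1P => [efe|/imsetP[x xA ef]]; first by rewrite efe eqxx in nef.
have [_ _ exq] := hq' x xA; rewrite -ef in exq.
by rewrite (third_uniq eE fE nef efg exq); move: xA; rewrite in_setI => /andP[].
Qed.

(** These stand for linear functionals: in ['F_2] the values on a line sum to zero. *)
Definition line_additive (l : T -> 'F_2) := forall e f g,
  e \in E -> f \in E -> e != f -> third e f g -> l g = (l e + l f)%R.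

(** The coordinate dual to [b]: nonmembership in the hyperplane spanned by [B :\ b]. *)
Definition hcoord B b e : 'F_2 := ((e \notin cl (B :\ b)) : nat)%:R%R.

Lemma hcoord_additive B b : indep B -> #|B| = n -> b \in B -> line_additive (hcoord B b).
Proof.
move=> iB cB bB e f g eE fE nef efg; rewrite /hcoord.
have gE : g \in E by case/and3P: efg.
have egf := third_rot matM simpM eE fE nef efg.
have /andP[neg nfg] := third_neq efg.
have fge : third f g e by apply: third_rot; rewrite // 1?eq_sym // thirdC.
have [eH|eH] := boolP (e \in _); have [fH|fH] := boolP (f \in _) => /=.
- by rewrite (third_cl efg) // add0r.
- rewrite (_ : g \notin _) ?add0r //.
  by apply: contra fH; apply: third_cl egf eH.
- rewrite (_ : g \notin _) ?addr0 //.
  by apply: contra eH; apply: third_cl fge fH.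
by rewrite (hyperplane_third iB cB bB eE fE) // addrr_F2.
Qed.

Lemma hcoord_basis B b x : indep B -> b \in B -> x \in B -> hcoord B b x = ((x == b) : nat)%:R%R.
Proof.
move=> iB bB xB; rewrite /hcoord; have [->|nxb] := eqVneq x b.
  by rewrite (_ : b \notin _) //; apply: indepU1_cl; rewrite // ?setD1K // !inE eqxx.
by rewrite mem_cl // !inE nxb.
Qed.

Lemma sum_hcoord B b (k : T -> 'F_2) X : indep B -> X \subset B -> b \in X ->
  (\sum_(x in X) k x * hcoord B b x)%R = k b.
Proof.
move=> iB sXB bX; have bB := subsetP sXB b bX.
rewrite (bigD1 b) //= hcoord_basis // eqxx mulr1 big1 ?addr0 // => x /andP[xX nxb].
by rewrite hcoord_basis ?(subsetP sXB) // (negPf nxb) mulr0.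
Qed.

(** For [e] off [B], a basis inside [e |: B] containing [e] omits some [b] in [B], so it is
    [e |: B :\ b]. *)
Lemma hcoord_neq0 B e : indep B -> #|B| = n -> e \in E -> exists2 b, b \in B & e \notin cl (B :\ b).
Proof.
move=> iB cB eE; have [eB|eB] := boolP (e \in B).
  by exists e => //; apply: indepU1_cl; rewrite // ?setD1K // !inE eqxx.
have ie : indep [set e] by move: eE; rewrite in_set.
have [J [seJ sJ iJ cJ]] := basis_extend matM ie (subsetUl [set e] B).
have {}cJ : #|J| = n.
  apply/eqP; rewrite eqn_leq -{1}rM card_leq_rk ?subsetT //= cJ -cB.
  by rewrite card_leq_rk // subsetUr.
have [b bB bJ] : exists2 b, b \in B & b \notin J.
  apply/exists_inP; rewrite -negb_forall_in; apply/forall_inP => sBJ.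
  have : #|e |: B| <= #|J|.
    by apply: subset_leq_card; rewrite subUset seJ; apply/subsetP.
  by rewrite cardsU1 eB cB cJ ltnn.
exists b => //; apply: indepU1_cl => //; first by rewrite !inE (negPf eB) andbF.
suff -> : e |: B :\ b = J by [].
apply/esym/eqP; rewrite eqEcard cardsU1 !inE (negPf eB) andbF cJ -cB (cardsD1 b B) bB leqnn andbT.
apply/subsetP => x xJ; case/setU1P: (subsetP sJ x xJ) => [->|xB]; first by rewrite setU11.
by rewrite !inE xB andbT orbC; case: eqP => // xb; rewrite xb (negPf bJ) in xJ.
Qed.

(** Adding points along lines collapses a combination to zero or to one point. The outcome is the
    same for all [f], so a relation can be tested on any of them. *)
Lemma line_additive_sum (l : seq T) (k : T -> 'F_2) : {subset l <= E} ->
  (forall f, line_additive f -> \sum_(x <- l) k x * f x = 0)%R \/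
  (exists2 z, z \in E & forall f, line_additive f -> f z = \sum_(x <- l) k x * f x)%R.
Proof.
elim: l => [|x l IH] slE; first by left=> f _; rewrite big_nil.
have xE : x \in E by apply: slE; rewrite mem_head.
have {}IH := IH (fun y yl => slE y (@mem_behead _ (x :: l) y yl)).
have [kx|kx] := F2_cases (k x).
  case: IH => [h|[z zE h]]; [left=> f lf | right; exists z => // f lf];
    by rewrite big_cons kx mul0r add0r ?h.
case: IH => [h|[z zE h]].
  by right; exists x => // f lf; rewrite big_cons kx mul1r h // addr0.
have [exz|nxz] := eqVneq x z.
  by left=> f lf; rewrite big_cons kx mul1r -h // exz addrr_F2.
have [g xzg] := third_exists xE zE nxz; right; exists g; first by case/and3P: xzg.
by move=> f lf; rewrite big_cons kx mul1r -h // (lf x z g).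
Qed.

(** The points with image in the span of [C] have full rank and are closed under third points, so
    the size bound makes them all of [E]. *)
Lemma span_basis (V : lmodType 'F_2) (phi : T -> V) C x :
  (forall e f g, e \in E -> f \in E -> e != f -> third e f g -> phi g = phi e + phi f)%R ->
  indep C -> #|C| = n -> C \subset E -> x \in E ->
  exists k : {ffun T -> 'F_2}, phi x = (\sum_(y in C) k y *: phi y)%R.
Proof.
move=> phi_third iC cC sCE xE.
pose F := [set e in E | [exists k : {ffun T -> 'F_2}, phi e == (\sum_(y in C) k y *: phi y)%R]].
have sFE : F \subset E by apply/subsetP => e; rewrite in_set => /andP[].
suff : x \in F by rewrite in_set => /andP[_ /existsP[k /eqP]]; exists k.
suff -> : F = E by [].
apply/eqP; rewrite eqEcard sFE (leq_trans cE) // -(Mrt_size1 n) -(nonloops_restriction sFE).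
apply: card_nonloops_bound => //.
- exact: restriction_matroid.
- exact: restriction_simple.
- rewrite rk_restriction setTI; apply/eqP; rewrite eqn_leq -{1}rM rk_sub ?subsetT //=.
  rewrite -cC card_leq_rk //; apply/subsetP => c cC'.
  rewrite in_set (subsetP sCE) //=; apply/existsP; exists [ffun y => ((y == c) : nat)%:R%R].
  rewrite (bigD1 c) //= ffunE eqxx scale1r big1 ?addr0 // => y /andP[_ nyc].
  by rewrite ffunE (negPf nyc) scale0r.
apply: restriction_noclaw => // e f; rewrite ![_ \in F]in_set.
move=> /andP[eE /existsP[ke /eqP he]] /andP[fE /existsP[kf /eqP hf]] nef.
have [g efg] := third_exists eE fE nef; exists g => //.
rewrite in_set; case/and3P: (efg) => -> _ _ /=; apply/existsP.
exists [ffun y => (ke y + kf y)%R]; rewrite (phi_third e f g) // he hf -big_split /=.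
by apply/eqP; apply: eq_bigr => y _; rewrite ffunE scalerDl.
Qed.

Lemma projective_coordinates : exists phi : T -> 'rV['F_2]_n,
  [/\ {in E &, injective phi}, forall e, e \in E -> phi e != 0%R &
      forall X, X \subset E -> indep X = free [seq phi x | x <- enum X]].
Proof.
have [B _ [iB cB]] := rk_basis matM setT; rewrite rM in cB.
pose b (i : 'I_n) := enum_val (cast_ord (esym cB) i).
have bB i : b i \in B by apply: enum_valP.
pose phi e : 'rV['F_2]_n := (\row_i hcoord B (b i) e)%R.
have phi_row i : line_additive (fun e => phi e 0%R i).
  by move=> e f g eE fE nef efg; rewrite !mxE; apply: hcoord_additive efg.
have phi_third e f g : e \in E -> f \in E -> e != f -> third e f g -> phi g = (phi e + phi f)%R.
  by move=> eE fE nef efg; apply/rowP => i; rewrite [RHS]mxE; apply: (phi_row i e f g).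
have phi0 e : e \in E -> phi e != 0%R.
  move=> eE; have [c cB' ec] := hcoord_neq0 iB cB eE.
  apply/eqP => /rowP/(_ (cast_ord cB (enum_rank_in cB' c))).
  by rewrite !mxE /b cast_ordK enum_rankK_in // /hcoord ec.
(* Equal images would make the image of the third point zero. *)
have phi_inj : {in E &, injective phi}.
  move=> e f eE fE eef; apply/eqP/negPn/negP => nef.
  have [g efg] := third_exists eE fE nef; have gE : g \in E by case/and3P: efg.
  by have := phi0 g gE; rewrite (phi_third e f g) // eef addrr_row eqxx.
exists phi; split=> // X sXE.
have phi_sum (Y : {set T}) k z : (forall f, line_additive f -> f z = \sum_(x <- enum Y) k x * f x)%R ->
    phi z = (\sum_(x in Y) k x *: phi x)%R.
  move=> h; apply/rowP => i; rewrite (h _ (phi_row i)) big_enum summxE.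
  by apply: eq_bigr => x _; rewrite !mxE.
have enumE (Y : {set T}) : Y \subset E -> {subset enum Y <= E}.
  by move=> /subsetP sYE x; rewrite mem_enum; apply: sYE.
apply/idP/idP => [iX|/free_enumP freeX].
  (* Either the relation holds for every line-additive function, and the coordinate dual to [x] in a
     basis containing [X] reads off [k x]; or it yields [phi z = 0] for a nonloop [z]. *)
  apply/free_enumP => k hk x xX.
  have [h|[z zE h]] := line_additive_sum k (enumE _ sXE).
    have [C [sXC _ iC cC]] := basis_extend matM iX (subsetT X); rewrite rM in cC.
    have := h _ (hcoord_additive iC cC (subsetP sXC x xX)).
    by rewrite big_enum sum_hcoord.
  by have := phi0 z zE; rewrite (phi_sum _ _ _ h) hk eqxx.
(* If a basis [I] of [X] is not all of [X], expand [phi x], for [x] in [X] off [I], over a basis [C]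
   containing [I], to obtain a linear relation on [X]. *)
have [I [_ sIX iI cI]] := basis_extend matM (indep0 matM) (sub0set X).
have [<- //|nIX] := eqVneq I X.
have [x xX xI] : exists2 x, x \in X & x \notin I.
  by apply/subsetPn; apply: contra nIX => sXI; rewrite eqEsubset sIX.
have xE := subsetP sXE x xX.
have xcl : x \in cl I.
  rewrite in_set eqn_leq [X in _ && X]rk_sub ?subsetUr // andbT.
  move: (iI); rewrite (indepE matM) => /eqP->; rewrite cI rk_sub //.
  by rewrite subUset sub1set xX.
have [C [sIC _ iC cC]] := basis_extend matM iI (subsetT I); rewrite rM in cC.
have sCE : C \subset E by apply/subsetP => y yC; apply: (nonloopsP matM iC).
have [k hk] : exists k : {ffun T -> 'F_2}, phi x = (\sum_(y in C) k y *: phi y)%R.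
  exact: (span_basis phi_third iC cC sCE xE).
(* The coordinate dual to [y] vanishes at [x], because [x] is in the closure of [I], a subset of
   [C :\ y]. *)
have kI y : y \in C -> y \notin I -> k y = 0%R.
  move=> yC yI; have [h|[z zE h]] := line_additive_sum k (enumE _ sCE).
    have := phi0 x xE; rewrite hk; case/eqP; apply/rowP => i.
    rewrite summxE [RHS]mxE -[RHS](h _ (phi_row i)) big_enum.
    by apply: eq_bigr => u _; rewrite !mxE.
  have zx : z = x by apply: phi_inj => //; rewrite (phi_sum _ _ _ h) hk.
  have := h _ (hcoord_additive iC cC yC); rewrite big_enum sum_hcoord // zx => <-.
  by rewrite /hcoord (cl_mono matM _ xcl) // subsetD1 sIC.
(* In characteristic 2 the coefficient of [x] may be taken as 1. *)
pose k' y := if y == x then 1%R else if y \in I then k y else 0%R.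
suff : k' x = 0%R by rewrite /k' eqxx => /eqP; rewrite oner_eq0.
apply: freeX => //; rewrite (bigD1 x) //= /k' eqxx scale1r.
suff <- : phi x = (\sum_(y in X | y != x) k' y *: phi y)%R by rewrite addrr_row.
rewrite hk (big_setID I) /= (setIidPr sIC) [X in (_ + X)%R]big1 ?addr0; last first.
  by move=> y; rewrite inE => /andP[yI yC]; rewrite kI // scale0r.
rewrite [RHS]big_mkcond [LHS]big_mkcond /=; apply: eq_bigr => y _.
rewrite /k'; have [->|_] := eqVneq y x; first by rewrite (negPf xI) andbF.
rewrite andbT; have [yI|yI] := boolP (y \in I); first by rewrite (subsetP sIX).
by rewrite scale0r; case: ifP.
Qed.
End Geometry.

(** * Gluing the coordinates of the summands into an isomorphism *)

Lemma projective_embedding (T : finType) (indep : {set T} -> bool) n :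
  0 < n -> extremal n 1 indep -> exists f : T -> PG_type n,
    {in nonloops indep &, injective f} /\
    forall X : {set T}, X \subset nonloops indep -> indep X = PG_indep (f @: X).
Proof.
move=> n0 ext; have [phi [phi_inj phi0 indepE]] := projective_coordinates n0 ext.
(* A default value for [insubd], nonzero because [n] is positive; it is never taken on nonloops. *)
have one0 : (const_mx 1 : 'rV['F_2]_n)%R != 0%R.
  by apply/eqP => /rowP/(_ (Ordinal n0)); rewrite !mxE => /eqP; rewrite oner_eq0.
pose f x : PG_type n := insubd (exist (fun v : 'rV['F_2]_n => is_true (v != 0%R)) _ one0) (phi x).
have fE x : x \in nonloops indep -> val (f x) = phi x by move=> xE; rewrite val_insubd phi0.
have f_inj : {in nonloops indep &, injective f}.
  by move=> x y xE yE exy; apply: phi_inj; rewrite // -!fE // exy.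
exists f; split=> // X sXE; rewrite indepE // /PG_indep.
have fX_inj : {in X &, injective f} by move=> x y /(subsetP sXE) + /(subsetP sXE); apply: f_inj.
have -> : [seq phi x | x <- enum X] = [seq val u | u <- [seq f x | x <- enum X]].
  rewrite -map_comp; apply/eq_in_map => x; rewrite mem_enum /= => xX.
  by rewrite fE // (subsetP sXE).
apply/perm_free/perm_map/uniq_perm; rewrite ?enum_uniq //.
  by rewrite map_inj_in_uniq ?enum_uniq // => x y; rewrite !mem_enum; apply: fX_inj.
move=> u; rewrite mem_enum; apply/mapP/imsetP => -[x xX ->]; exists x => //; by rewrite mem_enum in xX *.
Qed.

Lemma extremal_iso (T : finType) (indep : {set T} -> bool) r t :
  0 < t -> 2 * t <= r -> extremal r t indep -> nonloops indep = setT ->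
  matroid_iso indep (@Mrt_indep r t).
Proof.
move=> t0 le_t ext ET.
have [P [PE Pdisj extP indepP]] := extremal_decomposition t0 le_t ext.
have [matM simpM rM nc cE] := ext.
have n0 i : 0 < Mrt_rank r t i.
  by rewrite /Mrt_rank addn_gt0 divn_gt0 //; lia.
have sPE i : P i \subset nonloops indep by rewrite -PE bigcup_sup.
have /fin_all_exists[psi hpsi] i := projective_embedding (n0 i) (extP i).
have psi_inj i : {in P i &, injective (psi i)}.
  by have [+ _] := hpsi i; rewrite nonloops_restriction.
have indep_psi i (X : {set T}) : X \subset P i -> indep X = PG_indep (psi i @: X).
  have [_ +] := hpsi i; rewrite nonloops_restriction // => h sX.
  by rewrite -h // /restriction sX.
have /fin_all_exists[c cP] : forall x, exists i, x \in P i.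
  move=> x; have : x \in \bigcup_i P i by rewrite PE ET inE.
  by case/bigcupP => i _ xi; exists i.
pose f x : Mrt_type r t := Tagged (fun i => PG_type (Mrt_rank r t i)) (psi (c x) x).
have fE x i : x \in P i -> f x = Tagged (fun i => PG_type (Mrt_rank r t i)) (psi i x).
  by move=> xi; rewrite -(Pdisj _ _ _ (cP x) xi).
have f_inj : injective f.
  move=> x y exy; have ecxy : c x = c y by have := congr1 tag exy.
  have yc : y \in P (c x) by rewrite ecxy.
  move/eqP: exy; rewrite (fE _ _ (cP x)) (fE _ _ yc) eq_Tagged => /eqP.
  exact: psi_inj.
exists f; split.
  (* Surjectivity comes from counting: the lower bound says that the target is no larger than
     [T]. *)
  apply: inj_card_bij f_inj _; rewrite card_Mrt_type -cardsT -ET.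
  exact: card_nonloops_bound.
move=> X; rewrite indepP ?ET ?subsetT // /Mrt_indep /dsum_indep; apply: eq_forallb => i.
rewrite (indep_psi i) ?subsetIr //; congr PG_indep; apply/setP => u; rewrite in_set.
apply/imsetP/imsetP => -[x].
  by rewrite in_setI => /andP[xX xi] ->; exists x; rewrite // (fE _ _ xi).
move=> xX eu; have eci : c x = i by have := congr1 tag eu.
have xi : x \in P i by rewrite -eci.
exists x; first by rewrite inE xX.
by move/eqP: eu; rewrite (fE _ _ xi) eq_Tagged => /eqP.
Qed.

Theorem theorem1p1 (r t : nat) (hr : 0 < r) (ht : 0 < t)
  (T : finType) (indep : {set T} -> bool) :
  is_matroid indep -> simple_matroid indep -> mrank indep [set: T] = r ->
  (forall S : {set T}, is_claw indep S -> #|S| <> t.+1) ->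
  #|Mrt_type r t| <= #|T| /\
  (#|T| = #|Mrt_type r t| -> 2 * t <= r -> matroid_iso indep (@Mrt_indep r t)).
Proof.
move=> matM simpM rM noclawM.
have ET : nonloops indep = setT.
  by apply/setP => e; rewrite !inE -[[set e]]setUid; apply: simpM.
have simp : simple_on indep by move=> e f _ _; apply: simpM.
have nc : noclaw indep t.
  move=> S clS; rewrite leqNgt; apply/negP => ltS.
  (* The hypothesis excludes only claws of size exactly [t.+1]; a larger claw is cut down to that
     size. *)
  pose S' := [set x in take t.+1 (enum S)].
  have sS'S : S' \subset S.
    by apply/subsetP => x; rewrite inE => /mem_take; rewrite mem_enum.
  have /(clawP matM)[iS' flatS'] := claw_sub matM sS'S clS.
  apply: (noclawM S').
    split=> // e eS'; rewrite rk_notin_cl //; apply: contra eS'; apply: flatS'.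
    by rewrite ET inE.
  by rewrite cardsE (card_uniqP _) ?take_uniq ?enum_uniq // size_takel // -cardE.
rewrite card_Mrt_type -cardsT -ET; split; first exact: card_nonloops_bound.
by move=> eT le_t; apply: extremal_iso => //; split; rewrite // eT.
Qed.
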